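(* Let $\mathbb{F}$ be an algebraically closed field with $\operatorname{char}\mathbb{F}\ne 2$, let $n\ge 4$ and $k\ge 3$ be integers, and let $$\mathfrak{p}(x_1,\dots,x_k)=\sum_{\sigma\in\mathcal{S}_k}\alpha_\sigma\, x_{\sigma(1)}\cdots x_{\sigma(k)}\qquad(\alpha_\sigma\in\mathbb{F})$$ be a homogeneous multilinear polynomial in noncommuting variables with $\sum_{\sigma\in\mathcal{S}_k}\alpha_\sigma\ne 0$. Let $\mathfrak{D}_1,\mathfrak{D}_2\subseteq\mathcal{M}_n(\mathbb{F})$ be subsets each of which contains all matrices of rank one and all idempotents of rank $n-1$. If a surjection $\Phi:\mathfrak{D}_1\to\mathfrak{D}_2$ strongly preserves the zeros of $\mathfrak{p}$, then there exist a field isomorphism $\varphi:\mathbb{F}\to\mathbb{F}$, functions $\gamma:\mathfrak{D}_1\setminus\{0\}\to\mathbb{F}\setminus\{0\}$ and $\mu:\mathfrak{D}_1\to\mathbb{F}$, and an invertible matrix $T\in\mathcal{M}_n(\mathbb{F})$ such that (i) $\Phi(A)=\gamma(A)\,T A^{\varphi}T^{-1}+\mu(A)\,\mathrm{Id}$ for all $A\in\mathfrak{D}_1$, or (ii) $\Phi(A)=\gamma(A)\,T (A^{\varphi})^{\mathrm{tr}}T^{-1}+\mu(A)\,\mathrm{Id}$ for all $A\in\mathfrak{D}_1$, where for $A=0$ (if $0\in\mathfrak{D}_1$) the first summand is read as $0$.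
   Context: $\mathcal{M}_n(\mathbb{F})$ is the algebra of $n\times n$ matrices over $\mathbb{F}$ with identity $\mathrm{Id}$; $\mathcal{S}_k$ is the set of all permutations of $\{1,\dots,k\}$. For matrices, $\mathfrak{p}(A_1,\dots,A_k)=\sum_{\sigma}\alpha_\sigma A_{\sigma(1)}\cdots A_{\sigma(k)}$. A map $\Phi:\mathfrak{D}_1\to\mathfrak{D}_2$ strongly preserves the zeros of $\mathfrak{p}$ if for all $A_1,\dots,A_k\in\mathfrak{D}_1$: $\mathfrak{p}(A_1,\dots,A_k)=0\Longleftrightarrow\mathfrak{p}(\Phi(A_1),\dots,\Phi(A_k))=0$. No linearity or additivity of $\Phi$ is assumed. $A^\varphi$ is the matrix obtained from $A$ by applying $\varphi$ entrywise, and $A^{\mathrm{tr}}$ is the transpose of $A$. *)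

(* Defs.v *)
From HB Require Import structures.
From mathcomp Require Import all_boot all_order all_fingroup all_algebra.

Set Implicit Arguments.
Unset Strict Implicit.
Unset Printing Implicit Defensive.

Import GRing.Theory.
Local Open Scope ring_scope.

(* The multilinear polynomial with coefficient family [alpha] is represented by
   its values on matrices.  The product is taken in increasing order of [i],
   so the summand of [s] is alpha_s A_(s 0) A_(s 1) ... A_(s (k-1)). *)
Definition mleval (F : fieldType) (n k : nat) (alpha : 'S_k -> F)
    (A : 'I_k -> 'M[F]_n) : 'M[F]_n :=
  \sum_(s : 'S_k) alpha s *: \prod_(i < k) A (s i).

(* A map D1 -> D2 is represented by a total function of which only the values
   on D1 matter. *)
Definition surjection_between (T : Type) (D1 D2 : T -> Prop) (Phi : T -> T) :
    Prop :=
  (forall A, D1 A -> D2 (Phi A)) /\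
  (forall B, D2 B -> exists2 A, D1 A & Phi A = B).

Definition strongly_preserves_zeros (F : fieldType) (n k : nat)
    (alpha : 'S_k -> F) (D1 : 'M[F]_n -> Prop) (Phi : 'M[F]_n -> 'M[F]_n) :
    Prop :=
  forall A : 'I_k -> 'M[F]_n, (forall i, D1 (A i)) ->
    (mleval alpha A = 0 <-> mleval alpha (fun i => Phi (A i)) = 0).

Definition contains_rank1 (F : fieldType) (n : nat) (D : 'M[F]_n -> Prop) :
    Prop :=
  forall A : 'M[F]_n, \rank A = 1%N -> D A.

Definition contains_corank1_idempotents (F : fieldType) (n : nat)
    (D : 'M[F]_n -> Prop) : Prop :=
  forall P : 'M[F]_n, P *m P = P -> \rank P = n.-1 -> D P.

(* Main.v *)
Require Import Defs.
From HB Require Import structures.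
From mathcomp Require Import all_boot all_order all_fingroup all_algebra.
From mathcomp Require Import ring zify.
From Stdlib Require Import Classical ClassicalEpsilon.

Set Implicit Arguments.
Unset Strict Implicit.
Unset Printing Implicit Defensive.

Import GRing.Theory.
Local Open Scope ring_scope.

(* An antiflag is a pair (x, f) with f(x) != 0, encoding the rank-one matrix
   x f, a nonzero multiple of an idempotent.  Writing A _|_ B when p vanishes
   on all tuples having B in one slot and A in the other ones, a matrix P with
   P^2 = c P, c != 0, satisfies P _|_ B iff PB = BP = 0 (this is where the
   coefficient sum is used), and the B with A _|_ B form a space stable under
   both multiplications by A, hence contain a rank-one matrix as soon as they
   are not all zero.  Taking A = 1 - E with E idempotent of rank one shows that
   Phi sends antiflags to antiflags and preserves their orthogonality.

   Double orthogonals detect whether two antiflags share their vector or their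
   form, so Phi induces (up to exchanging vectors and forms) an incidence
   preserving pair of maps on lines and hyperplanes, which coordinates show to
   be semilinear.

   Finally, for orthogonal antiflags P, Q, the condition PAQ = QAP = 0 is
   expressed by zeros of p with A in one slot, P in another one and Q in the
   rest, or with P and Q exchanged.  Transported back by the semilinear map,
   Phi(A) therefore becomes a matrix B with fB in <f, fA> for every form f,
   which forces B = c A + d. *)

(** * The bilinear pairing on row vectors *)


Section LinearAlgebra.
Variables (F : fieldType) (n : nat).
Implicit Types (x y z f g h u v w : 'rV[F]_n) (A B : 'M[F]_n) (a b c d : F).

(** Linear forms and vectors are both row vectors, so that exchanging them is a literal symmetry of
    all later statements. *)
Definition dot f x : F := (f *m x^T) 0 0.

Lemma dotC f x : dot f x = dot x f.
Proof. by rewrite /dot -[f *m _]trmxK trmx_mul trmxK mxE. Qed.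

Lemma mul_dot f x : f *m x^T = (dot f x)%:M.
Proof. exact: mx11_scalar. Qed.

Lemma dot0l x : dot 0 x = 0.
Proof. by rewrite /dot mul0mx mxE. Qed.

Lemma dot0r f : dot f 0 = 0.
Proof. by rewrite dotC dot0l. Qed.

Lemma dotDl f g x : dot (f + g) x = dot f x + dot g x.
Proof. by rewrite /dot mulmxDl mxE. Qed.

Lemma dotZl a f x : dot (a *: f) x = a * dot f x.
Proof. by rewrite /dot -scalemxAl mxE. Qed.

Lemma dotDr f x y : dot f (x + y) = dot f x + dot f y.
Proof. by rewrite !(dotC f) dotDl. Qed.

Lemma dotZr a f x : dot f (a *: x) = a * dot f x.
Proof. by rewrite !(dotC f) dotZl. Qed.

Lemma dotNl f x : dot (- f) x = - dot f x.
Proof. by rewrite -scaleN1r dotZl mulN1r. Qed.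

Lemma dotNr f x : dot f (- x) = - dot f x.
Proof. by rewrite !(dotC f) dotNl. Qed.

Lemma dotM f A x : dot (f *m A) x = dot f (x *m A^T).
Proof. by rewrite /dot trmx_mul trmxK mulmxA. Qed.

Lemma dot_neq0l f x : dot f x != 0 -> f != 0.
Proof. by apply: contraNneq => ->; rewrite dot0l. Qed.

Lemma dot_neq0r f x : dot f x != 0 -> x != 0.
Proof. by rewrite dotC; apply: dot_neq0l. Qed.

Lemma dot_delta f i : dot f (delta_mx 0 i) = f 0 i.
Proof. by rewrite /dot trmx_delta -colE mxE. Qed.

(** The columns of [cokermx U] span the forms vanishing on the rows of [U], and [v] lies in the row
    space exactly when they all vanish at [v]. *)
Lemma dot_sep m (U : 'M[F]_(m, n)) v :
  ~~ (v <= U)%MS -> exists2 h, U *m h^T = 0 & dot h v != 0.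
Proof.
rewrite submxE => /rV0Pn[j vj].
exists (col j (cokermx U))^T.
  by rewrite trmxK colE mulmxA mulmx_coker mul0mx.
by rewrite dotC /dot trmxK colE mulmxA -colE mxE.
Qed.

Lemma dot_sepP m (U : 'M[F]_(m, n)) v :
  (forall h, U *m h^T = 0 -> dot v h = 0) -> (v <= U)%MS.
Proof.
move=> Uv; apply/negPn/negP => /dot_sep[h /Uv]; rewrite dotC => ->.
by rewrite eqxx.
Qed.

Lemma sep1 x v : ~~ (v <= x)%MS -> exists2 h, dot h x = 0 & dot h v != 0.
Proof.
move=> /dot_sep[h xh hv]; exists h => //.
by rewrite dotC /dot xh mxE.
Qed.

(** A space is not the union of two proper subspaces: if [h] misses [w] and [k] misses [v], their
    sum catches both. *)
Lemma sep1_two x v w : ~~ (v <= x)%MS -> ~~ (w <= x)%MS ->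
  exists h, [/\ dot h x = 0, dot h v != 0 & dot h w != 0].
Proof.
move=> /sep1[h hx hv] /sep1[k kx kw].
have [hw|] := eqVneq (dot h w) 0; last by exists h.
have [kv|] := eqVneq (dot k v) 0; last by exists k.
by exists (h + k); rewrite !dotDl hx kx hw kv !addr0 add0r.
Qed.

Lemma sub2P f g v :
  reflect (exists a b, v = a *: f + b *: g) (v <= col_mx f g)%MS.
Proof.
rewrite -addsmxE; apply: (iffP sub_addsmxP) => [[[u w] /= ->]|[a [b ->]]].
  by exists (u 0 0), (w 0 0); rewrite -!mul_scalar_mx -!mx11_scalar.
by exists (a%:M, b%:M); rewrite !mul_scalar_mx.
Qed.

Lemma col_mx_dot0 f g h :
  (col_mx f g *m h^T == 0) = (dot f h == 0) && (dot g h == 0).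
Proof.
have E c : (c%:M == 0 :> 'M[F]_1) = (c == 0).
  apply/eqP/eqP => [/matrixP/(_ 0 0)|->]; last by rewrite raddf0.
  by rewrite !mxE eqxx mulr1n.
by rewrite mul_col_mx col_mx_eq0 !mul_dot !E.
Qed.

End LinearAlgebra.

(** * Local linear dependence *)


Section Independence.
Variables (F : fieldType) (n : nat).
Implicit Types (x y z f g h u v w e : 'rV[F]_n) (A B : 'M[F]_n) (a b c d : F).

Lemma indep2 z e c d : ~~ (z <= e)%MS -> c *: z + d *: e = 0 -> c = 0.
Proof.
move=> ze; apply: contra_eq => c0; apply: contra ze => /eqP cde.
apply/sub_rVP; exists (- (c^-1 * d)); apply: (scalerI c0).
rewrite scalerA mulrN mulrA mulfV // mul1r scaleNr.
by apply/eqP; rewrite -addr_eq0 cde.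
Qed.

Lemma indep3 w e z a b c :
  ~~ (w <= col_mx e z)%MS -> a *: w + b *: e + c *: z = 0 -> a = 0.
Proof.
move=> ze; apply: contra_eq => a0; apply: contra ze => /eqP cde.
apply/sub2P; exists (- (a^-1 * b)), (- (a^-1 * c)); apply: (scalerI a0).
rewrite scalerDr !scalerA !mulrN !mulrA mulfV // !mul1r !scaleNr.
by apply/eqP; rewrite -opprD -addr_eq0 addrA cde.
Qed.

Lemma exists_notin m (U : 'M[F]_(m, n)) : (\rank U < n)%N ->
  exists v, ~~ (v <= U)%MS.
Proof.
move=> Un; have /row_subPn[i Ui] : ~~ ((1%:M : 'M[F]_n) <= U)%MS.
  by rewrite sub1mx /row_full neq_ltn Un.
by exists (row i 1%:M).
Qed.

Lemma exists_notin3 e z w : (4 <= n)%N -> exists v, ~~ (v <= col_mx (col_mx e z) w)%MS.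
Proof. by move=> n4; apply: exists_notin; apply: leq_trans n4; rewrite ltnS rank_leq_row. Qed.

(* If every g outside <f, f A> had f in <g, g A>, then A would act as a scalar
   modulo f on two vectors independent modulo <f, f A>, and a combination of
   these would be an eigenvector. *)
Lemma exists_transversal A f : (4 <= n)%N -> f != 0 ->
  exists2 g : 'rV[F]_n, ~~ (g <= col_mx f (f *m A))%MS & ~~ (f <= col_mx g (g *m A))%MS.
Proof.
move=> n4 f0; set U := col_mx f (f *m A); apply: NNPP => noT.
have fU : (f <= U)%MS by apply/sub2P; exists 1, 0; rewrite scale1r scale0r addr0.
have act g : ~~ (g <= U)%MS -> exists a b, g *m A = a *: g + b *: f /\ b != 0.
  move=> gU; have : (f <= col_mx g (g *m A))%MS.
    by apply/negPn/negP => fg; apply: noT; exists g.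
  case/sub2P => [a [b fE]].
  have b0 : b != 0.
    apply/eqP => b0; have fa : f = a *: g by rewrite [LHS]fE b0 scale0r addr0.
    have a0 : a != 0 by apply: contraNneq f0 => a0; rewrite fa a0 scale0r.
    by move: gU; rewrite -(eqmx_scale g a0) -fa fU.
  exists (- (b^-1 * a)), b^-1; rewrite invr_eq0; split=> //.
  apply: (scalerI b0); rewrite scalerDr !scalerA mulrN mulrA mulfV // mul1r.
  by rewrite scale1r fE scaleNr addKr.
have [g1 g1U] : exists v, ~~ (v <= U)%MS.
  by apply: exists_notin; apply: leq_trans n4; rewrite ltnS (leq_trans (rank_leq_row _)).
have [g2 g2U] := exists_notin3 f (f *m A) g1 n4.
have g2U' : ~~ (g2 <= U)%MS.
  by apply: contra g2U => ?; rewrite -addsmxE (submx_trans _ (addsmxSl _ _)).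
have g12 c d : ((c *: g1 + d *: g2)%R <= U)%MS -> c = 0 /\ d = 0.
  move=> cd; have d0 : d = 0.
    apply: contraNeq g2U => d0; rewrite -addsmxE -(eqmx_scale g2 d0).
    rewrite -[d *: g2](addKr (c *: g1)) addmx_sub //.
      by rewrite -scaleNr scalemx_sub // addsmxSr.
    exact: submx_trans cd (addsmxSl _ _).
  move: cd; rewrite d0 scale0r addr0 => cg1; split=> //.
  by apply: contraNeq g1U => c0; rewrite -(eqmx_scale g1 c0).
have [a1 [b1 [E1 b10]]] := act _ g1U.
have [a2 [b2 [E2 b20]]] := act _ g2U'.
have g12U : ~~ ((g1 + g2)%R <= U)%MS.
  apply/negP; rewrite -[g1 in (g1 + _)%R]scale1r -[g2]scale1r => /g12[/eqP].
  by rewrite oner_eq0.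
(* Comparing [g1], [g2] and [g1 + g2] modulo [U] shows that the three scalars [a1], [a2], [a3]
   agree. *)
have [a3 [b3 [E3 _]]] := act _ g12U.
have : (((a1 - a3) *: g1 + (a2 - a3) *: g2)%R <= U)%MS.
  have -> : (a1 - a3) *: g1 + (a2 - a3) *: g2 = (b3 - b1 - b2) *: f.
    move: E3; rewrite mulmxDl E1 E2 => E3; apply/eqP; rewrite -subr_eq0.
    apply/eqP; move/eqP: E3; rewrite -subr_eq0 => /eqP E3; rewrite -[RHS]E3.
    by apply/rowP => i; rewrite !mxE; ring.
  exact: scalemx_sub.
case/g12 => /subr0_eq a13 /subr0_eq a23.
(* This combination cancels the components along [f], so it is an eigenvector outside [U], whereas
   [act] gives it a nonzero component along [f]. *)
have g3U : ~~ ((b2 *: g1 + - b1 *: g2)%R <= U)%MS.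
  by apply/negP => /g12[/eqP]; rewrite (negPf b20).
have [a [b [Eg b0]]] := act _ g3U.
have : (((a3 - a) *: (b2 *: g1 + - b1 *: g2))%R <= U)%MS.
  have -> : (a3 - a) *: (b2 *: g1 + - b1 *: g2) = b *: f.
    move: Eg; rewrite mulmxDl -!scalemxAl E1 E2 a13 a23 => Eg.
    apply/eqP; rewrite -subr_eq0; apply/eqP.
    move/eqP: Eg; rewrite -subr_eq0 => /eqP Eg; rewrite -[RHS]Eg.
    by apply/rowP => i; rewrite !mxE; ring.
  exact: scalemx_sub.
have [a3a|a3a] := eqVneq (a3 - a) 0; last by rewrite (eqmx_scale _ a3a) (negPf g3U).
move=> _; move: Eg; rewrite mulmxDl -!scalemxAl E1 E2 a13 a23 (subr0_eq a3a) => Eg.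
have : b *: f = 0.
  move/eqP: Eg; rewrite -subr_eq0 => /eqP Eg; rewrite -[RHS]oppr0 -[in RHS]Eg.
  by apply/rowP => i; rewrite !mxE; ring.
by move/eqP; rewrite scaler_eq0 (negPf b0) (negPf f0).
Qed.

(** By duality it suffices to treat the [y] killed by [f] and fA. A transversal [g] supplies an [x]
    with f(x) nonzero on which [g] and gA vanish, so the hypothesis applies as soon as g(y) is
    nonzero. *)
Lemma local_span A B : (4 <= n)%N ->
  (forall x f y g, dot f x != 0 -> dot g y != 0 -> dot f y = 0 -> dot g x = 0 ->
     dot (f *m A) y = 0 -> dot (g *m A) x = 0 -> dot (f *m B) y = 0) ->
  forall f, (f *m B <= col_mx f (f *m A))%MS.
Proof.
move=> n4 H f; have [->|f0] := eqVneq f 0; first by rewrite mul0mx sub0mx.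
have [g gU fg] := exists_transversal A n4 f0.
have [x xg fx] := dot_sep fg.
have [y0 y0U gy0] := dot_sep gU.
move/eqP: xg; rewrite col_mx_dot0 => /andP[/eqP gx /eqP gAx].
move/eqP: y0U; rewrite col_mx_dot0 => /andP[/eqP fy0 /eqP fAy0].
rewrite dotC in fx; rewrite dotC in gy0.
apply: dot_sepP => y /eqP; rewrite col_mx_dot0 => /andP[/eqP fy /eqP fAy].
(* If [g] kills [y], the hypothesis applies to [y0] and to [y + y0], and the difference gives the
   claim for [y]. *)
have [gy|gy] := eqVneq (dot g y) 0; last by apply: (H x f y g).
have : dot (f *m B) (y + y0) = 0.
  apply: (H x f _ g); rewrite ?dotDr ?fy ?fAy ?fy0 ?fAy0 ?gy ?add0r ?addr0 //.
by rewrite dotDr (H x f y0 g) // addr0.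
Qed.

End Independence.


Section LocalDependence.
Variables (F : fieldType) (n : nat).
Implicit Types (x y z f g h u v w e : 'rV[F]_n) (A B : 'M[F]_n) (a b c d : F).

(** The factor is read off at one [z0] not killed by [A]; linearity propagates it to every other
    vector by comparing [z] with [z + z0]. *)
Lemma local_multiple A B :
  (forall z, (z *m B <= z *m A)%MS) -> exists c, B = c *: A.
Proof.
move=> H; have [A0|] := eqVneq A 0.
  exists 1; apply/row_matrixP => i.
  have /sub_rVP[c] := H (delta_mx 0 i).
  by rewrite A0 mulmx0 !scaler0 -rowE row0.
move=> /rowV0Pn[w /submxP[z0 wE] w0]; rewrite {}wE in w0.
have /sub_rVP[c Ec] := H z0; exists c; apply/eqP; rewrite -subr_eq0; apply/eqP.
set C := B - _.
have HC z : (z *m C <= z *m A)%MS.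
  by rewrite mulmxBr -scalemxAr addmx_sub // eqmx_opp scalemx_sub.
have z0C : z0 *m C = 0 by rewrite mulmxBr -scalemxAr Ec subrr.
apply/row_matrixP => i; rewrite row0 rowE; move: (delta_mx 0 i) => z.
(* If zA is a multiple of the image of [z0], a translate of [z] by a multiple of [z0] is killed by
   [A], hence by [C]. Otherwise the images are independent and coefficients are compared. *)
have [/sub_rVP[t zt]|zz0] := boolP (z *m A <= z0 *m A)%MS.
  have := HC (z - t *: z0).
  by rewrite !mulmxBl -!scalemxAl zt z0C subrr scaler0 subr0 => /submx0null.
have /sub_rVP[a Ea] := HC z; have /sub_rVP[b] := HC (z + z0).
rewrite !mulmxDl z0C addr0 Ea => /eqP; rewrite scalerDr -subr_eq0 opprD addrA.
rewrite -scalerBl -scaleNr => /eqP/[dup]/(indep2 zz0) ab; rewrite ab scale0r add0r.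
move/eqP; rewrite scaler_eq0 (negPf w0) orbF oppr_eq0 => /eqP b0.
by rewrite -[a]subr0 -b0 ab scale0r.
Qed.

(** Adding [e] to [z] changes neither zA nor zB, so a component of zB along [z] would force one
    along [e] as well. This is conclusive unless zA is a nonzero multiple of [e]; such a special [z]
    is handled by adding a nonspecial vector. *)
Lemma local_kernel A B e : (4 <= n)%N -> e != 0 -> e *m A = 0 -> e *m B = 0 ->
  (forall z, (z *m B <= col_mx z (z *m A))%MS) ->
  forall z, (z *m B <= z *m A)%MS.
Proof.
move=> n4 e0 eA eB H.
have nonspecial z : ~~ [&& z *m A <= e & z *m A != 0]%MS -> (z *m B <= z *m A)%MS.
  move=> nsp; have [/sub_rVP[c ->]|ze] := boolP (z <= e)%MS.
    by rewrite -scalemxAl eB scaler0 sub0mx.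
  have /sub2P[a [b Ez]] := H z.
  have /sub2P[a' [b']] := H (z + e).
  rewrite !mulmxDl eA eB !addr0 => Eze.
  have [|zA] := boolP (z *m A <= col_mx z e)%MS; last first.
    have E0 : (b - b') *: (z *m A) + (a - a') *: z + - a' *: e = 0.
      move/eqP: Eze; rewrite Ez -subr_eq0 => /eqP E; rewrite -[RHS]E.
      by apply/rowP => i; rewrite !mxE; ring.
    have b0 := indep3 zA E0; move: E0; rewrite b0 scale0r add0r => E0.
    have aa := indep2 ze E0; move/eqP: E0.
    rewrite aa scale0r add0r scaler_eq0 (negPf e0) orbF oppr_eq0 => /eqP a'0.
    by rewrite Ez (subr0_eq aa) a'0 scale0r add0r scalemx_sub.
  case/sub2P => [p [q EA]].
  have [p0|p0] := eqVneq p 0.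
    have zA0 : z *m A = 0.
      apply/eqP; move: nsp; rewrite negb_and negbK EA p0 scale0r add0r.
      by rewrite scalemx_sub.
    have E0 : (a - a') *: z + - a' *: e = 0.
      move/eqP: Eze; rewrite Ez zA0 -subr_eq0 => /eqP E; rewrite -[RHS]E.
      by apply/rowP => i; rewrite !mxE; ring.
    have aa := indep2 ze E0; move/eqP: E0.
    rewrite aa scale0r add0r scaler_eq0 (negPf e0) orbF oppr_eq0 => /eqP a'0.
    by rewrite Ez (subr0_eq aa) a'0 zA0 scale0r scaler0 addr0 sub0mx.
  (* The translate of [z] proportional to zA has the same image under [B], and for it the span of
     the vector and its image is just the line of zA. *)
  have zA : z *m A = p *: (z + (q / p) *: e).
    by rewrite EA scalerDr scalerA mulrCA mulfV // mulr1.
  have /sub2P[c [d]] := H (z + (q / p) *: e).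
  rewrite !mulmxDl -!scalemxAl eA eB !scaler0 !addr0 => ->.
  rewrite addmx_sub ?scalemx_sub // zA.
  by rewrite (eqmx_scale _ p0).
move=> z; have [|] := boolP [&& z *m A <= e & z *m A != 0]%MS; last exact: nonspecial.
case/andP => /sub_rVP[b zA] zA0.
have b0 : b != 0 by apply: contraNneq zA0 => b0; rewrite zA b0 scale0r.
have ze : ~~ (z <= e)%MS.
  by apply: contra zA0 => /sub_rVP[c ->]; rewrite -scalemxAl eA scaler0.
have [c [d zB]] : exists c d, z *m B = c *: z + d *: e.
  by have /sub2P[c [d ->]] := H z; exists c, (d * b); rewrite zA scalerA.
suff c0 : c = 0.
  by rewrite zB zA c0 scale0r add0r (eqmx_scale _ b0) scalemx_sub.
(* If some wA is independent of [e] and [z], then [w] and [z + w] are both nonspecial, and comparing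
   them isolates the coefficient [c]. *)
have [|/row_subPn[i]] := boolP (A <= col_mx e z)%MS; last first.
  rewrite rowE; move: (delta_mx 0 i) => w wA.
  have wAe : ~~ (w *m A <= e)%MS.
    by apply: contra wA => ?; rewrite -addsmxE (submx_trans _ (addsmxSl _ _)).
  have /sub_rVP[g wB] : (w *m B <= w *m A)%MS.
    by apply: nonspecial; rewrite (negPf wAe).
  have /sub_rVP[k] : ((z + w)%R *m B <= (z + w)%R *m A)%MS.
    apply: nonspecial; rewrite mulmxDl zA; apply: contra wAe => /andP[bw _].
    by rewrite -[w *m A](addKr (b *: e)) addmx_sub // -scaleNr scalemx_sub.
  rewrite !mulmxDl zB zA wB => /eqP; rewrite -subr_eq0 => /eqP E.
  have E0 : (g - k) *: (w *m A) + (d - k * b) *: e + c *: z = 0.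
    by rewrite -[RHS]E; apply/rowP => j; rewrite !mxE; ring.
  have gk := indep3 wA E0; move: E0; rewrite gk scale0r add0r addrC.
  exact: indep2.
move=> Aez.
(* Here [A] has rank at most 2, so its kernel has dimension at least 2 because n >= 4; a second
   kernel vector replaces [w]. *)
have [e' e'A e'e] : exists2 e' : 'rV[F]_n, e' *m A = 0 & ~~ (e' <= e)%MS.
  have /row_subPn[i] : ~~ (kermx A <= e)%MS.
    apply: contraL n4 => /mxrankS; rewrite mxrank_ker => re.
    rewrite -ltnNge ltnS; have := leq_trans (mxrankS Aez) (rank_leq_row _).
    have := leq_trans re (rank_leq_row _); have := rank_leq_row A.
    by move: (\rank A) => r; lia.
  by exists (row i (kermx A)) => //; rewrite -row_mul mulmx_ker row0.
have e'ez : ~~ (e' <= col_mx e z)%MS.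
  apply: contra e'e => /sub2P[p [q eE]]; move: e'A.
  rewrite eE mulmxDl -!scalemxAl eA scaler0 add0r => /eqP.
  by rewrite scaler_eq0 (negPf zA0) orbF => /eqP ->; rewrite scale0r addr0 scalemx_sub.
have e'B : e' *m B = 0.
  have : (e' *m B <= e' *m A)%MS by apply: nonspecial; rewrite e'A eqxx andbF.
  by rewrite e'A => /submx0null.
have /sub2P[m [l]] := H (z + e').
rewrite !mulmxDl e'B e'A !addr0 zA zB => /eqP; rewrite -subr_eq0 => /eqP E.
have E0 : - m *: e' + (d - l * b) *: e + (c - m) *: z = 0.
  by rewrite -[RHS]E; apply/rowP => j; rewrite !mxE; ring.
have m0 := indep3 e'ez E0; move: E0; rewrite m0 scale0r add0r addrC.
by move/(indep2 ze); rewrite addr0.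
Qed.

End LocalDependence.

(** An eigenvector of [A], which exists over a closed field, is also one of [B]. Subtracting the two
    eigenvalues gives matrices with a common kernel vector, to which the two preceding lemmas
    apply. *)
Lemma local_affine (F : closedFieldType) n (A B : 'M[F]_n) : (4 <= n)%N ->
  (forall f : 'rV_n, (f *m B <= col_mx f (f *m A))%MS) ->
  exists c d, B = c *: A + d%:M.
Proof.
move=> n4 H.
have [a] : exists a, root (char_poly A) a.
  apply/closed_rootP; rewrite size_char_poly.
  by case: (n) n4.
rewrite -eigenvalue_root_char => /eigenvalueP[e eA e0].
have /sub_rVP[b eB] : (e *m B <= e)%MS.
  have /sub2P[p [q ->]] := H e.
  by rewrite eA scalerA -scalerDl scalemx_sub.
have [] := @local_multiple _ _ (A - a%:M) (B - b%:M).
  apply: (@local_kernel _ _ _ _ e) => //.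
  - by rewrite mulmxBr mul_mx_scalar eA subrr.
  - by rewrite mulmxBr mul_mx_scalar eB subrr.
  move=> z; have /sub2P[p [q E]] := H z; apply/sub2P.
  exists (p - b + q * a), q.
  by rewrite !mulmxBr !mul_mx_scalar E; apply/rowP => i; rewrite !mxE; ring.
move=> c E; exists c, (b - c * a); apply/eqP; rewrite -subr_eq0.
move/eqP: E; rewrite -subr_eq0 => /eqP E; rewrite -E; apply/eqP/matrixP => i j.
by rewrite !mxE; case: (i == j) => /=; rewrite ?mulr1n ?mulr0n; ring.
Qed.

Lemma local_orthogonal (F : closedFieldType) n (A B : 'M[F]_n) : (4 <= n)%N ->
  (forall x f y g, dot f x != 0 -> dot g y != 0 -> dot f y = 0 -> dot g x = 0 ->
     (dot (f *m A) y = 0 /\ dot (g *m A) x = 0) <->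
     (dot (f *m B) y = 0 /\ dot (g *m B) x = 0)) ->
  exists c d, c != 0 /\ B = c *: A + d%:M.
Proof.
move=> n4 H.
have [c [d BE]] : exists c d, B = c *: A + d%:M.
  apply: local_affine => //; apply: local_span => // x f y g fx gy fy gx fA gA.
  by have [] := (H x f y g fx gy fy gx).1 (conj fA gA).
have [c' [d' AE]] : exists c d, A = c *: B + d%:M.
  apply: local_affine => //; apply: local_span => // x f y g fx gy fy gx fA gA.
  by have [] := (H x f y g fx gy fy gx).2 (conj fA gA).
(* If [c] vanishes then [B] is scalar, hence so is [A] by the symmetric relation, and the factor 1
   serves with an adjusted constant. *)
have [c0|c0] := eqVneq c 0; last by exists c, d.
exists 1, (d - (c' * d + d')); rewrite oner_neq0; split=> //.
rewrite [in RHS]AE BE c0; apply/matrixP => i j.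
by rewrite !mxE; case: (i == j) => /=; rewrite ?mulr1n ?mulr0n; ring.
Qed.

(** * Collineations in coordinates *)


Lemma rmorphism_of (R S : nzRingType) (f : R -> S) :
  {morph f : a b / a + b} -> {morph f : a b / a * b} -> f 1 = 1 ->
  exists phi : {rmorphism R -> S}, phi =1 f.
Proof.
move=> fD fM f1.
have f0 : f 0 = 0 by apply: (addrI (f 0)); rewrite -fD !addr0.
have fB : zmod_morphism f.
  move=> a b; apply: (addIr (f b)); rewrite -fD !subrK //.
pose fA := GRing.isZmodMorphism.Build R S f fB.
pose fMM := GRing.isMonoidMorphism.Build R S f (conj f1 fM).
pose phi : {rmorphism R -> S} := HB.pack f fA fMM.
by exists phi.
Qed.

Section NormalizedFrame.
Variables (F : fieldType) (n : nat) (n4 : (4 <= n)%N).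
Variables sigma tau : 'rV[F]_n -> 'rV[F]_n.
Hypothesis incident : forall x f : 'rV[F]_n, x != 0 -> f != 0 ->
  (dot f x == 0) = (dot (tau f) (sigma x) == 0).
Hypothesis sigma_neq0 : forall x : 'rV[F]_n, x != 0 -> sigma x != 0.
Hypothesis sigma_delta : forall i : 'I_n,
  (sigma (delta_mx 0 i) <= (delta_mx 0 i : 'rV[F]_n))%MS.
Hypothesis sigma_one : (sigma (const_mx 1) <= (const_mx 1 : 'rV[F]_n))%MS.
Implicit Types (x f : 'rV[F]_n) (i j l m : 'I_n) (a b c : F).

Let e i : 'rV[F]_n := delta_mx 0 i.

Lemma e_neq0 i : e i != 0.
Proof.
by apply/eqP => /rowP/(_ i)/eqP; rewrite !mxE !eqxx oner_eq0.
Qed.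

Lemma dot_e f i : dot f (e i) = f 0 i.
Proof. exact: dot_delta. Qed.

Lemma sigma_e i : exists2 c, c != 0 & sigma (e i) = c *: e i.
Proof.
have /sub_rVP[c Ec] := sigma_delta i; exists c => //.
by apply: contraNneq (sigma_neq0 (e_neq0 i)) => c0; rewrite Ec c0 scale0r.
Qed.

(** A coordinate of [f] is its value at a basis vector, whose line [sigma] fixes; so [tau] preserves
    supports. *)
Lemma tau_coord0 f i : f != 0 -> (tau f 0 i == 0) = (f 0 i == 0).
Proof.
move=> f0; rewrite -(dot_e f) incident ?e_neq0 //.
by have [c c0 ->] := sigma_e i; rewrite dotZr dot_e mulf_eq0 (negPf c0).
Qed.

Lemma tau_e i : exists2 c, c != 0 & tau (e i) = c *: e i.
Proof.
exists (tau (e i) 0 i); first by rewrite tau_coord0 ?e_neq0 // !mxE !eqxx oner_eq0.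
apply/rowP => j; rewrite !mxE eqxx /=; have [->|ji] := eqVneq j i; first by rewrite mulr1.
by apply/eqP; rewrite mulr0 tau_coord0 ?e_neq0 // !mxE (negPf ji).
Qed.

Lemma sigma_coord0 x i : x != 0 -> (sigma x 0 i == 0) = (x 0 i == 0).
Proof.
move=> x0; rewrite -(dot_e x) -(dot_e (sigma x)) !(dotC _ (e i)) (incident x0) ?e_neq0 //.
by have [c c0 ->] := tau_e i; rewrite dotZl mulf_eq0 (negPf c0).
Qed.

Lemma dot_supp f x (s : seq 'I_n) : uniq s -> (forall i, i \notin s -> f 0 i = 0) ->
  dot f x = \sum_(i <- s) f 0 i * x 0 i.
Proof.
move=> us fs; rewrite /dot mxE (bigID (mem s)) /= [X in _ + X]big1 ?addr0.
  by rewrite big_uniq //=; apply: eq_bigr => i _; rewrite mxE.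
by move=> i /fs ->; rewrite mul0r.
Qed.

Let ratio i j a : 'rV[F]_n := e i - a *: e j.
(** The hyperplane on which coordinate [i] is [a] times coordinate [j] goes to the analogous
    hyperplane with ratio [psi i j a]. These maps turn out to be one field automorphism. *)
Definition psi i j a := - (tau (ratio i j a) 0 j / tau (ratio i j a) 0 i).

Lemma ratioE i j a l : ratio i j a 0 l = (l == i)%:R - a * (l == j)%:R.
Proof. by rewrite !mxE !eqxx. Qed.

Lemma ratio_i i j a : i != j -> ratio i j a 0 i = 1.
Proof. by move=> ij; rewrite ratioE eqxx (negPf ij) mulr0 subr0. Qed.

Lemma ratio_neq0 i j a : i != j -> ratio i j a != 0.
Proof.
by move=> ij; apply/eqP => /rowP/(_ i)/eqP; rewrite ratio_i // mxE oner_eq0.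
Qed.

Lemma tau_ratio_i i j a : i != j -> tau (ratio i j a) 0 i != 0.
Proof. by move=> ij; rewrite tau_coord0 ?ratio_neq0 // ratio_i ?oner_neq0. Qed.

Lemma sigma_ratio x i j a : i != j -> x != 0 ->
  (x 0 i == a * x 0 j) = (sigma x 0 i == psi i j a * sigma x 0 j).
Proof.
move=> ij x0; have r0 := ratio_neq0 a ij; have ti := tau_ratio_i a ij.
have := incident x0 r0.
have uij : uniq [:: i; j] by rewrite /= inE ij.
rewrite !(@dot_supp _ _ [:: i; j]) //; first last.
- move=> l; rewrite !inE negb_or => /andP[li lj].
  by rewrite ratioE (negPf li) (negPf lj) mulr0 subr0.
- move=> l; rewrite !inE negb_or => /andP[li lj]; apply/eqP.
  by rewrite tau_coord0 // ratioE (negPf li) (negPf lj) mulr0 subr0.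
rewrite !big_cons !big_nil !addr0 ratio_i // ratioE eqxx (eq_sym j) (negPf ij).
rewrite mul1r sub0r mulr1 mulNr subr_eq0 => ->.
rewrite -[RHS]subr_eq0 -[RHS]orFb -(negPf ti) -mulf_eq0; congr (_ == 0).
by rewrite /psi; field.
Qed.

Lemma one_neq0 : (const_mx 1 : 'rV[F]_n) != 0.
Proof.
case: n n4 => // p _; apply/eqP => /rowP/(_ 0)/eqP.
by rewrite !mxE oner_eq0.
Qed.

Lemma psi1 i j : i != j -> psi i j 1 = 1.
Proof.
move=> ij; have := sigma_ratio 1 ij one_neq0; have /sub_rVP[c Ec] := sigma_one.
have : sigma (const_mx 1) 0 j != 0 by rewrite sigma_coord0 ?one_neq0 // mxE oner_eq0.
rewrite Ec !mxE !mulr1 => c0; rewrite eqxx -subr_eq0 -{1}[c]mul1r -mulrBl.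
by rewrite mulf_eq0 (negPf c0) orbF subr_eq0 => /esym/eqP.
Qed.

(** The point with coordinates ab, b, 1 at [i], [j], [l] lies on the three ratio hyperplanes
    involved. *)
Lemma psiM i j l a b : i != j -> j != l -> i != l ->
  psi i l (a * b) = psi i j a * psi j l b.
Proof.
move=> ij jl il; pose x := (a * b) *: e i + b *: e j + e l.
have xE p : x 0 p = a * b * (p == i)%:R + b * (p == j)%:R + (p == l)%:R.
  by rewrite !mxE !eqxx.
have xi : x 0 i = a * b.
  by rewrite xE eqxx (negPf ij) (negPf il) mulr0 !addr0 mulr1.
have xj : x 0 j = b.
  by rewrite xE eqxx eq_sym (negPf ij) (negPf jl) mulr0 add0r addr0 mulr1.
have xl : x 0 l = 1.
  by rewrite xE eqxx !(eq_sym l) (negPf jl) (negPf il) !mulr0 !add0r.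
have x0 : x != 0.
  by apply/eqP => /rowP/(_ l)/eqP; rewrite xl mxE oner_eq0.
have sl : sigma x 0 l != 0 by rewrite sigma_coord0 // xl oner_eq0.
have := sigma_ratio (a * b) il x0; rewrite xi xl mulr1 eqxx => /esym/eqP Eil.
have := sigma_ratio b jl x0; rewrite xj xl mulr1 eqxx => /esym/eqP Ejl.
have := sigma_ratio a ij x0; rewrite xj xi eqxx => /esym/eqP Eij.
by apply: (mulIf sl); rewrite -Eil Eij Ejl mulrA.
Qed.

Lemma exists_other (s : seq 'I_n) : (size s < n)%N -> exists j, j \notin s.
Proof.
move=> sn; apply: NNPP => no; have: (#|'I_n| <= size s)%N.
  apply: leq_trans (card_size s); apply/subset_leq_card/subsetP => j _.
  by apply/negPn/negP => js; apply: no; exists j.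
by rewrite card_ord leqNgt sn.
Qed.

(** Multiplying by the ratio 1, which [psi1] shows to be fixed, changes one index at a time. *)
Lemma psi_left i j l a : i != l -> j != l -> psi i l a = psi j l a.
Proof.
move=> il jl; have [->//|ij] := eqVneq i j.
by rewrite -[a in LHS]mul1r (psiM _ _ ij) // psi1 // mul1r.
Qed.

Lemma psi_right i j l a : i != j -> i != l -> psi i j a = psi i l a.
Proof.
move=> ij il; have [->//|jl] := eqVneq j l.
by rewrite -[a in RHS]mulr1 (psiM _ _ ij) // psi1 // mulr1.
Qed.

Lemma psi_const i j i' j' a : i != j -> i' != j' -> psi i j a = psi i' j' a.
Proof.
move=> ij ij'; have [|l] := @exists_other [:: i; i'].
  by apply: leq_trans n4.
rewrite !inE negb_or => /andP[li li'].
have il : i != l by rewrite eq_sym.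
have il' : i' != l by rewrite eq_sym.
by rewrite (psi_right a ij il) (psi_left a il il') (psi_right a il' ij').
Qed.

(** Addition is encoded by the form e_i - e_j - e_l: [tau] sends it to a multiple of itself, and it
    kills the point with coordinates a + b, a, b. *)
Lemma psiD i j a b : i != j -> psi i j (a + b) = psi i j a + psi i j b.
Proof.
move=> ij; have [|l] := @exists_other [:: i; j]; first exact: leq_trans n4.
rewrite !inE negb_or => /andP[li lj].
have [|m] := @exists_other [:: i; j; l]; first exact: leq_trans n4.
rewrite !inE !negb_or => /and3P[mi mj ml].
pose f := e i - e j - e l.
have fE p : f 0 p = (p == i)%:R - (p == j)%:R - (p == l)%:R by rewrite !mxE !eqxx.
have il : i != l by rewrite eq_sym.
have jl : j != l by rewrite eq_sym.
have fi : f 0 i = 1 by rewrite fE eqxx (negPf ij) (negPf il) !subr0.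
have fj : f 0 j = -1 by rewrite fE eqxx (eq_sym j) (negPf ij) (negPf jl) subr0 sub0r.
have fl : f 0 l = -1 by rewrite fE eqxx (negPf li) (negPf lj) subrr sub0r.
have f0 : f != 0 by apply/eqP => /rowP/(_ i)/eqP; rewrite fi mxE oner_eq0.
have fs p : p \notin [:: i; j; l] -> f 0 p = 0.
  rewrite !inE !negb_or fE => /and3P[/negPf-> /negPf-> /negPf->].
  by rewrite !subr0.
have ts p : p \notin [:: i; j; l] -> tau f 0 p = 0.
  by move=> /fs fp; apply/eqP; rewrite tau_coord0 // fp.
have us : uniq [:: i; j; l] by rewrite /= !inE negb_or ij il jl.
have dotf x : dot (tau f) x = tau f 0 i * x 0 i + tau f 0 j * x 0 j + tau f 0 l * x 0 l.
  by rewrite (dot_supp _ us ts) !big_cons big_nil addr0 addrA.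
have dotf' x : dot f x = x 0 i - x 0 j - x 0 l.
  rewrite (dot_supp _ us fs) !big_cons big_nil addr0 fi.
  by rewrite fj fl; ring.
have ti : tau f 0 i != 0 by rewrite tau_coord0 // fi oner_eq0.
(* The point e_i + e_p is killed by [f], and its image has equal coordinates at [i] and [p]; this
   makes the coefficients of [tau f] there opposite. *)
have pair p q : i != p -> i != q -> q != p ->
    (forall x, dot (tau f) x = tau f 0 i * x 0 i + tau f 0 p * x 0 p + tau f 0 q * x 0 q) ->
    (forall x, dot f x = x 0 i - x 0 p - x 0 q) -> tau f 0 p = - tau f 0 i.
  move=> ip iq qp dtf df; pose x := e i + e p.
  have xE r : x 0 r = (r == i)%:R + (r == p)%:R by rewrite !mxE !eqxx.
  have xp : x 0 p = 1 by rewrite xE eqxx (eq_sym p) (negPf ip) add0r.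
  have xi : x 0 i = 1 by rewrite xE eqxx (negPf ip) addr0.
  have xq : x 0 q = 0 by rewrite xE (eq_sym q i) (negPf iq) (negPf qp) addr0.
  have x0 : x != 0 by apply/eqP => /rowP/(_ i)/eqP; rewrite xi mxE oner_eq0.
  have sp : sigma x 0 p != 0 by rewrite sigma_coord0 // xp oner_eq0.
  have sq : sigma x 0 q = 0 by apply/eqP; rewrite sigma_coord0 // xq.
  have := sigma_ratio 1 ip x0; rewrite xi xp mulr1 eqxx psi1 // mul1r => /esym/eqP sip.
  have := incident x0 f0; rewrite df dtf sip sq xi xp xq.
  rewrite !subr0 !subrr mulr0 addr0 eqxx -mulrDl => /esym/eqP/eqP.
  by rewrite mulf_eq0 (negPf sp) orbF addrC addr_eq0 => /eqP.
have tj : tau f 0 j = - tau f 0 i by apply: (pair j l).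
have tl : tau f 0 l = - tau f 0 i.
  apply: (pair l j) => // x; first by rewrite dotf addrAC.
  by rewrite dotf' addrAC.
(* The coordinate 1 at a fourth index [m] serves as unit: every other coordinate of the image is
   read off by [psi] relative to it. *)
pose x := (a + b) *: e i + a *: e j + b *: e l + e m.
have xE p : x 0 p = (a + b) * (p == i)%:R + a * (p == j)%:R + b * (p == l)%:R + (p == m)%:R.
  by rewrite !mxE !eqxx.
have xi : x 0 i = a + b.
  by rewrite xE eqxx (negPf ij) (negPf il) (eq_sym i) (negPf mi) /=; ring.
have xj : x 0 j = a.
  by rewrite xE eqxx !(eq_sym j) (negPf ij) (negPf lj) (negPf mj) /=; ring.
have xl : x 0 l = b.
  by rewrite xE eqxx (negPf li) (negPf lj) (eq_sym l) (negPf ml) /=; ring.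
have xm : x 0 m = 1.
  by rewrite xE eqxx (negPf mi) (negPf mj) (negPf ml) /=; ring.
have x0 : x != 0 by apply/eqP => /rowP/(_ m)/eqP; rewrite xm mxE oner_eq0.
have sm : sigma x 0 m != 0 by rewrite sigma_coord0 // xm oner_eq0.
have coord p : p != m -> sigma x 0 p = psi i j (x 0 p) * sigma x 0 m.
  move=> pm; have := sigma_ratio (x 0 p) pm x0.
  by rewrite xm mulr1 eqxx => /esym/eqP ->; rewrite (psi_const _ pm ij).
have := incident x0 f0; rewrite dotf' dotf xi xj xl.
rewrite (_ : a + b - a - b = 0); last by ring.
rewrite eqxx tj tl.
have im : i != m by rewrite eq_sym.
have jm : j != m by rewrite eq_sym.
have lm : l != m by rewrite eq_sym.
rewrite (coord _ im) (coord _ jm) (coord _ lm) xi xj xl => /esym/eqP E.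
apply: (mulIf sm); apply: (mulfI ti).
apply/eqP; rewrite -subr_eq0; apply/eqP; rewrite -[RHS]E.
by ring.
Qed.

Lemma normalized_frame :
  exists phi : {rmorphism F -> F},
    (forall x, x != 0 -> exists2 c, c != 0 & sigma x = c *: map_mx phi x) /\
    (forall f, f != 0 -> exists2 c, c != 0 & tau f = c *: map_mx phi f).
Proof.
have [i0 _] : exists i, i \notin ([::] : seq 'I_n).
  by apply: exists_other; apply: leq_trans n4.
have [|i1] := @exists_other [:: i0]; first by apply: leq_trans n4.
rewrite !inE => i10.
have [|i2] := @exists_other [:: i0; i1]; first by apply: leq_trans n4.
rewrite !inE negb_or => /andP[i20 i21].
have [] := @rmorphism_of _ _ (psi i1 i0).
- by move=> a b; apply: psiD.
- move=> a b; rewrite (@psiM i1 i2 i0) //; last by rewrite eq_sym.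
  by congr (_ * _); apply: psi_const => //; rewrite eq_sym.
- exact: psi1.
move=> phi phiE; exists phi.
have psiE i j a : i != j -> psi i j a = phi a.
  by move=> ij; rewrite phiE; apply: psi_const.
have sE x : x != 0 -> exists2 c, c != 0 & sigma x = c *: map_mx phi x.
  move=> x0; have /rV0Pn[j xj] := x0.
  have sj : sigma x 0 j != 0 by rewrite sigma_coord0.
  have pj : phi (x 0 j) != 0 by rewrite fmorph_eq0.
  exists (sigma x 0 j / phi (x 0 j)); first by rewrite mulf_neq0 ?invr_neq0.
  apply/rowP => i; rewrite !mxE.
  have [->|ij] := eqVneq i j; first by rewrite divfK.
  have := sigma_ratio (x 0 i / x 0 j) ij x0; rewrite divfK // eqxx psiE //.
  by move=> /esym/eqP ->; rewrite fmorph_div; field.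
split=> // f f0; have /rV0Pn[j fj] := f0.
have tj : tau f 0 j != 0 by rewrite tau_coord0.
have pj : phi (f 0 j) != 0 by rewrite fmorph_eq0.
exists (tau f 0 j / phi (f 0 j)); first by rewrite mulf_neq0 ?invr_neq0.
apply/rowP => i; rewrite !mxE.
have [->|ij] := eqVneq i j; first by rewrite divfK.
(* This point is killed by [f]; as its image is already known up to a scalar, incidence determines
   the ratio of two coordinates of [tau f]. *)
pose x := f 0 j *: e i - f 0 i *: e j.
have xE p : x 0 p = f 0 j * (p == i)%:R - f 0 i * (p == j)%:R by rewrite !mxE !eqxx.
have x0 : x != 0.
  apply/eqP => /rowP/(_ i); rewrite xE mxE eqxx (negPf ij) mulr0 subr0 mulr1 => fj0.
  by rewrite fj0 eqxx in fj.
have [c c0 sx] := sE _ x0.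
have mx : map_mx phi x = phi (f 0 j) *: e i - phi (f 0 i) *: e j.
  apply/rowP => p; rewrite !mxE !eqxx rmorphB !rmorphM.
  by case: (p == i); case: (p == j); rewrite ?rmorph1 ?rmorph0.
have := incident x0 f0; rewrite sx mx dotZr !dotDr !dotNr !dotZr !dot_e.
rewrite [f 0 j * _]mulrC subrr eqxx mulf_eq0 (negPf c0) /= subr_eq0 => /esym/eqP E.
by apply: (mulfI pj); rewrite E; field.
Qed.

End NormalizedFrame.


(** * Reduction of a collineation to a normalized frame *)

Section Collineation.
Variables (F : fieldType) (n : nat) (n4 : (4 <= n)%N).
Variables sigma tau : 'rV[F]_n -> 'rV[F]_n.
Hypothesis incident : forall x f : 'rV[F]_n, x != 0 -> f != 0 ->
  (dot f x == 0) = (dot (tau f) (sigma x) == 0).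
Hypothesis sigma_neq0 : forall x : 'rV[F]_n, x != 0 -> sigma x != 0.
Implicit Types (x f : 'rV[F]_n).

(** The images of the basis vectors are independent because the [tau (e i)] form a dual family up to
    scalars. Rescaling them by the coordinates of the image of the all-ones vector makes that vector
    fixed as well. *)
Lemma adapted_basis : exists2 S : 'M[F]_n, S \in unitmx &
  (forall i, sigma (delta_mx 0 i) *m invmx S <= (delta_mx 0 i : 'rV[F]_n))%MS /\
  (sigma (const_mx 1) *m invmx S <= (const_mx 1 : 'rV[F]_n))%MS.
Proof.
pose e i : 'rV[F]_n := delta_mx 0 i.
have e0 i : e i != 0 by apply: e_neq0.
have ee i j : dot (e j) (e i) = (i == j)%:R.
  by rewrite /e dot_delta !mxE eqxx.
pose S0 := \matrix_i sigma (e i); pose W := \matrix_i tau (e i).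
pose d i := dot (tau (e i)) (sigma (e i)).
have d0 i : d i != 0 by rewrite /d -incident // ee eqxx oner_eq0.
have SW i j : (S0 *m W^T) i j = (i == j)%:R * d j.
  transitivity (dot (sigma (e i)) (tau (e j))).
    by rewrite /dot !mxE; apply: eq_bigr => k _; rewrite !mxE.
  rewrite dotC; have [->|ij] := eqVneq i j; first by rewrite mul1r.
  by apply/eqP; rewrite mul0r -incident // ee (negPf ij).
have S0u : S0 \in unitmx.
  suff /mulmx1_unit[] : S0 *m (W^T *m diag_mx (\row_i (d i)^-1)) = 1%:M by [].
  apply/matrixP => i j; rewrite mulmxA mul_mx_diag mxE SW !mxE.
  by rewrite mulfK.
pose t := sigma (const_mx 1) *m invmx S0.
have tS0 : t *m S0 = sigma (const_mx 1) by rewrite mulmxKV.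
have t0 i : t 0 i != 0.
  have : dot (sigma (const_mx 1)) (tau (e i)) != 0.
    by rewrite dotC -incident ?one_neq0 // dotC dot_delta mxE oner_eq0.
  rewrite -tS0 => H; apply: contraNneq H => ti0.
  rewrite /dot -mulmxA mxE big1 // => j _.
  have [->|ji] := eqVneq j i; first by rewrite ti0 mul0r.
  suff -> : (S0 *m (tau (e i))^T) j 0 = 0 by rewrite mulr0.
  transitivity ((S0 *m W^T) j i); last by rewrite SW (negPf ji) mul0r.
  by rewrite !mxE; apply: eq_bigr => k _; rewrite !mxE.
have Du : diag_mx t \in unitmx.
  rewrite unitmxE det_diag unitfE; apply/prodf_neq0 => i _; exact: t0.
exists (diag_mx t *m S0); first by rewrite unitmx_mul Du S0u.
have Su : diag_mx t *m S0 \in unitmx by rewrite unitmx_mul Du S0u.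
split=> [i|].
  have -> : sigma (delta_mx 0 i) = (t 0 i)^-1 *: (delta_mx 0 i *m (diag_mx t *m S0)).
    rewrite mulmxA -rowE row_diag_mx -scalemxAl scalerA mulVf // scale1r -rowE.
    by rewrite rowK.
  by rewrite -scalemxAl mulmxK // scalemx_sub.
rewrite -tS0.
have tE : t = const_mx 1 *m diag_mx t.
  by apply/rowP => i; rewrite mul_mx_diag !mxE mul1r.
by rewrite {1}tE -(mulmxA (const_mx 1)) mulmxK.
Qed.

Lemma collineation :
  (forall u : 'rV[F]_n, u != 0 -> exists2 x, x != 0 & (u <= sigma x)%MS) ->
  exists (phi : {rmorphism F -> F}) (S : 'M[F]_n),
  [/\ bijective phi, S \in unitmx,
      forall x, x != 0 -> exists2 c, c != 0 & sigma x = c *: (map_mx phi x *m S) &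
      forall f, f != 0 -> exists2 c, c != 0 & tau f = c *: (map_mx phi f *m (invmx S)^T)].
Proof.
move=> surj; have [S Su [Se S1]] := adapted_basis.
pose s x := sigma x *m invmx S; pose t f := tau f *m S^T.
have mulS_neq0 (u : 'rV_n) (U : 'M[F]_n) : U \in unitmx -> u != 0 -> u *m U != 0.
  by move=> Uu; apply: contra_neq => uU; rewrite -(mulmxK Uu u) uU mul0mx.
have [phi [sE tE]] : exists phi : {rmorphism F -> F},
    (forall x, x != 0 -> exists2 c, c != 0 & s x = c *: map_mx phi x) /\
    (forall f, f != 0 -> exists2 c, c != 0 & t f = c *: map_mx phi f).
  apply: normalized_frame => // [x f x0 f0|x x0].
  - by rewrite incident // /t dotM trmxK /s mulmxKV.
  - by apply: mulS_neq0; rewrite ?unitmx_inv ?sigma_neq0.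
exists phi, S; split=> //; last 2 first.
- by move=> x /sE[c c0 E]; exists c; rewrite // scalemxAl -E mulmxKV.
- by move=> f /tE[c c0 E]; exists c; rewrite // scalemxAl -E trmx_inv mulmxK ?unitmx_tr.
(* Lifting the line of the vector with entries 1 and [b] through [sigma] produces a preimage of [b]
   as a quotient of two coordinates. *)
have phi_surj b : exists a, phi a == b.
  have [j0 _] : exists i : 'I_n, i \notin ([::] : seq 'I_n).
    by apply: exists_other; apply: leq_trans n4.
  have [|j1] := @exists_other n [:: j0]; first by apply: leq_trans n4.
  rewrite inE => j10.
  pose u : 'rV[F]_n := delta_mx 0 j0 + b *: delta_mx 0 j1.
  have u0 : u 0 j0 = 1 by rewrite !mxE !eqxx (eq_sym j0) (negPf j10) mulr0 addr0.
  have u1 : u 0 j1 = b by rewrite !mxE !eqxx (negPf j10) mulr1 add0r.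
  have [|x x0 /sub_rVP[c uE]] := surj (u *m S).
    apply: mulS_neq0 => //; apply/eqP => /rowP/(_ j0)/eqP.
    by rewrite u0 mxE oner_eq0.
  have [c' c'0 sx] := sE _ x0.
  have uE' : u = (c * c') *: map_mx phi x.
    by rewrite -[u](mulmxK Su) uE -scalemxAl -/(s x) sx scalerA.
  exists (x 0 j1 / x 0 j0); rewrite fmorph_div.
  move: u0 u1; rewrite uE' !mxE => e1 e2.
  have x1 : phi (x 0 j0) != 0.
    by apply: contra_eq_neq e1 => ->; rewrite mulr0 eq_sym oner_eq0.
  have cc : c * c' != 0.
    by apply: contra_eq_neq e1 => ->; rewrite mul0r eq_sym oner_eq0.
  by apply/eqP; rewrite -e2 -[LHS]mul1r -e1; field.
exists (fun b => xchoose (phi_surj b)) => [a|b].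
  by apply: (fmorph_inj phi); exact: (eqP (xchooseP (phi_surj (phi a)))).
exact: (eqP (xchooseP (phi_surj b))).
Qed.

End Collineation.

(** * Antiflags and orthogonality *)


Section Antiflags.
Variables (F : fieldType) (n : nat) (n3 : (3 <= n)%N).
Local Notation V := 'rV[F]_n.
Implicit Types (x y z f g h : V) (a b c r s : V * V).

Definition antiflag a := dot a.2 a.1 != 0.
Definition orth a b := dot a.2 b.1 = 0 /\ dot b.2 a.1 = 0.
Definition same_point a b := (a.1 <= b.1)%MS.
Definition same_form a b := (a.2 <= b.2)%MS.
Definition flip a : V * V := (a.2, a.1).

(* [r] lies in the double orthogonal of [{a, b}] *)
Definition biorth a b r := forall c, antiflag c -> orth a c -> orth b c -> orth r c.

Lemma flipK a : flip (flip a) = a.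
Proof. by case: a. Qed.

Lemma antiflag_flip a : antiflag (flip a) = antiflag a.
Proof. by rewrite /antiflag dotC. Qed.

Lemma orth_flip a b : orth (flip a) (flip b) <-> orth a b.
Proof. by rewrite /orth /= (dotC a.1) (dotC b.1); tauto. Qed.

Lemma orthC a b : orth a b <-> orth b a.
Proof. by rewrite /orth; tauto. Qed.

Lemma biorth_flip a b r : biorth a b r -> biorth (flip a) (flip b) (flip r).
Proof.
move=> H c ac; rewrite -(flipK c) !orth_flip; apply: H.
by rewrite antiflag_flip.
Qed.

Lemma line_sym x y : x != 0 -> (x <= y)%MS -> (y <= x)%MS.
Proof.
move=> x0 /sub_rVP[c xE]; have c0 : c != 0.
  by apply: contraNneq x0 => c0; rewrite xE c0 scale0r.
by rewrite xE (eqmx_scale _ c0).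
Qed.

Lemma antiflag_neq0 a : antiflag a -> a.1 != 0 /\ a.2 != 0.
Proof. by move=> aa; rewrite (dot_neq0r aa) (dot_neq0l aa). Qed.

Lemma same_pointC a b : antiflag a -> antiflag b -> same_point a b = same_point b a.
Proof.
by move=> /antiflag_neq0[a0 _] /antiflag_neq0[b0 _]; apply/idP/idP; apply: line_sym.
Qed.

Lemma same_formC a b : antiflag a -> antiflag b -> same_form a b = same_form b a.
Proof. by move=> *; apply: (@same_pointC (flip a) (flip b)); rewrite antiflag_flip. Qed.

Lemma same_point_trans a b c : same_point a b -> same_point b c -> same_point a c.
Proof. exact: submx_trans. Qed.

Lemma same_form_trans a b c : same_form a b -> same_form b c -> same_form a c.
Proof. exact: submx_trans. Qed.

Lemma dot_sub x y f : (x <= y)%MS -> dot f y = 0 -> dot f x = 0.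
Proof. by move=> /sub_rVP[c ->] fy; rewrite dotZr fy mulr0. Qed.

Lemma antiflag_notin x f z : dot f x != 0 -> z != 0 -> dot f z = 0 -> ~~ (z <= x)%MS.
Proof.
move=> fx z0 fz; apply: contra fx => /(line_sym z0) xz.
by rewrite (dot_sub xz fz).
Qed.

(** Otherwise a form [h] vanishes at [a.1] but not at [b.1]; completed by a vector killed by [a.2],
    it gives an antiflag orthogonal to [a] and not to [b]. *)
Lemma biorth_self_point a b : antiflag a -> antiflag b -> biorth a a b -> same_point b a.
Proof.
move=> aa ab H; apply/negPn/negP => /sep1[h hx hy].
have haf : ~~ (h <= a.2)%MS.
  have h0 := dot_neq0l hy; apply: contra aa => /(line_sym h0) ah.
  by rewrite dotC (dot_sub ah) // dotC.
have [z za zh] := sep1 haf.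
case: (H (z, h)) => //=; first by rewrite /antiflag /= dotC.
- by split=> //=; rewrite dotC.
- by split=> //=; rewrite dotC.
by move=> _ /= hb; rewrite hb eqxx in hy.
Qed.

Lemma biorth_self a b : antiflag a -> antiflag b ->
  biorth a a b <-> same_point b a && same_form b a.
Proof.
move=> aa ab; split=> [H|/andP[ba ba'] c _ [ac ca] _].
  rewrite biorth_self_point //=.
  apply: (@biorth_self_point (flip a) (flip b)); rewrite ?antiflag_flip //.
  exact: biorth_flip.
by split; [rewrite dotC; apply: dot_sub ba' _; rewrite dotC | apply: dot_sub ba _].
Qed.

Lemma exists_common_zero f g : exists2 z, z != 0 & dot f z = 0 /\ dot g z = 0.
Proof.
have [|v] := @exists_notin _ _ _ (col_mx f g).
  by apply: leq_trans n3; rewrite ltnS rank_leq_row.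
case/dot_sep => h /eqP; rewrite col_mx_dot0 => /andP[/eqP fh /eqP gh] hv.
by exists h => //; apply: dot_neq0l hv.
Qed.

Lemma biorth_same_point a b r : antiflag a -> antiflag b -> antiflag r ->
  same_point b a -> biorth a b r ->
  same_point r a /\ (r.2 <= col_mx a.2 b.2)%MS.
Proof.
move=> aa ab ar ba H.
have test z h : dot a.2 z = 0 -> dot b.2 z = 0 -> dot h a.1 = 0 -> dot h z != 0 ->
    orth r (z, h).
  by move=> az bz ha hz; apply: H => //; split=> //=; apply: dot_sub ba _.
split.
  apply/negPn/negP => ra; have [z z0 [az bz]] := exists_common_zero a.2 b.2.
  have [h [ha hz hr]] := sep1_two (antiflag_notin aa z0 az) ra.
  by have [_ /= hr0] := test z h az bz ha hz; rewrite hr0 eqxx in hr.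
apply: dot_sepP => z /eqP; rewrite col_mx_dot0 => /andP[/eqP az /eqP bz].
have [->|z0] := eqVneq z 0; first by rewrite dot0r.
have [h ha hz] := sep1 (antiflag_notin aa z0 az).
by have [] := test z h az bz ha hz.
Qed.

(** The double orthogonal of two antiflags with a common point consists of that point with the forms
    in the span of theirs. Any member differing from [a] spans the same pencil with [a]. *)
Lemma adjacent_biorth a b r : antiflag a -> antiflag b -> antiflag r ->
  same_point a b -> biorth a b r -> ~~ (same_point r a && same_form r a) ->
  biorth a r b.
Proof.
move=> aa ab ar ab1; have ba1 : same_point b a by rewrite same_pointC.
move=> /(biorth_same_point aa ab ar ba1)[ra1 /sub2P[p [q rE]]].
rewrite ra1 /= => ra2 c ac [ac1 ca1] [rc1 cr1]; split; last exact: dot_sub ba1 _.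
have q0 : q != 0.
  apply: contraNneq ra2 => q0; rewrite /same_form rE q0 scale0r addr0.
  exact: scalemx_sub.
move: rc1; rewrite rE dotDl !dotZl ac1 mulr0 add0r => /eqP.
by rewrite mulf_eq0 (negPf q0) => /eqP.
Qed.

(* When neither the points nor the forms agree, [r] shares the point of [a] and
   lies in the double orthogonal of [{a, b}], but that of [{a, r}] misses [b]. *)
Lemma nonadjacent_witness a b : antiflag a -> antiflag b ->
  ~~ same_point a b -> ~~ same_form a b ->
  exists r, [/\ antiflag r, biorth a b r, ~~ (same_point r a && same_form r a) &
                ~ biorth a r b].
Proof.
move=> aa ab nx nf; have nf' : ~~ same_form b a by rewrite same_formC.
(* The form of the witness is [b.2], corrected by [a.2] when [b.2] vanishes at [a.1]. *)
have [p [q [q0 kx]]] : exists p q, q != 0 /\ dot (p *: a.2 + q *: b.2) a.1 != 0.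
  have [ba|ba] := eqVneq (dot b.2 a.1) 0.
    by exists 1, 1; rewrite oner_neq0 !scale1r dotDl ba addr0; split.
  by exists 0, 1; rewrite oner_neq0 scale1r scale0r add0r; split.
exists (a.1, p *: a.2 + q *: b.2); split=> //=.
- move=> c ac [ac1 ca1] [bc1 cb1]; split=> //=.
  by rewrite dotDl !dotZl ac1 bc1 !mulr0 addr0.
- rewrite negb_and; apply/orP; right; apply: contra nf'; rewrite /same_form /= => ka.
  rewrite -(eqmx_scale _ q0) -[q *: _](addKr (p *: a.2)) addmx_sub //.
  by rewrite -scaleNr scalemx_sub.
move=> H; have [z z0 [az bz]] := exists_common_zero a.2 b.2.
have [|h [ha hz hb]] := sep1_two (antiflag_notin aa z0 az) (_ : ~~ (b.1 <= a.1)%MS).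
  by rewrite -/(same_point b a) same_pointC.
have [] := H (z, h) => //=.
  by split=> //=; rewrite dotDl !dotZl az bz !mulr0 addr0.
by move=> _ /= hb0; rewrite hb0 eqxx in hb.
Qed.

Definition adjacent a b := same_point a b || same_form a b.
Definition same a b := same_point a b && same_form a b.

(** The right-hand side speaks of orthogonality only, up to [same], so adjacency is preserved by any
    correspondence preserving orthogonality. *)
Lemma adjacentP a b : antiflag a -> antiflag b ->
  adjacent a b <-> forall r, antiflag r -> biorth a b r -> ~~ same r a -> biorth a r b.
Proof.
move=> aa ab; split=> [/orP[ab1|ab2] r ar|H].
- exact: adjacent_biorth.
- move=> /biorth_flip abr ra; rewrite -[a]flipK -[r]flipK -[b]flipK.
  apply/biorth_flip/adjacent_biorth; rewrite ?antiflag_flip //.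
  by rewrite andbC.
apply/negPn/negP; rewrite negb_or => /andP[n1 n2].
by have [r [ar abr ra]] := nonadjacent_witness aa ab n1 n2; apply; apply: H.
Qed.

End Antiflags.


Lemma functional_choice (A B : Type) (P : A -> B -> Prop) :
  (forall x, exists y, P x y) -> exists f, forall x, P x (f x).
Proof.
move=> H; exists (fun x => proj1_sig (constructive_indefinite_description _ (H x))).
by move=> x; case: (constructive_indefinite_description _ _).
Qed.

(** * Correspondences of antiflags preserving orthogonality *)

Section Correspondence.
Variables (F : fieldType) (n : nat) (n4 : (4 <= n)%N).
Local Notation V := 'rV[F]_n.
Implicit Types (x y z f g h : V) (a b c r s : V * V) (H : V * V -> V * V -> Prop).

(** A relation rather than a map: a rank-one matrix fixes its antiflag only up to inverse rescalings
    of vector and form, and a relation can be reversed. *)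
Record orth_corr H : Prop := OrthCorr {
  corr_antiflag : forall a a', H a a' -> antiflag a /\ antiflag a';
  corr_left : forall a, antiflag a -> exists a', H a a';
  corr_right : forall a', antiflag a' -> exists a, H a a';
  corr_orth : forall a a' b b', H a a' -> H b b' -> orth a b <-> orth a' b' }.

Definition straight H := forall a a' b b', H a a' -> H b b' ->
  (same_point a b = same_point a' b') /\ (same_form a b = same_form a' b').

Lemma orth_corr_sym H : orth_corr H -> orth_corr (fun a b => H b a).
Proof.
case=> af l r o; split=> // [a a' /af[] //|a a' b b' aa' bb'].
by have [] := o _ _ _ _ aa' bb'.
Qed.

Lemma orth_corr_flip H : orth_corr H -> orth_corr (fun a b => H a (flip b)).
Proof.
case=> af l r o; split.
- by move=> a a' /af; rewrite antiflag_flip.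
- by move=> a /l[a' aa']; exists (flip a'); rewrite flipK.
- by move=> a'; rewrite -antiflag_flip => /r[a aa']; exists a.
- by move=> a a' b b' aa' bb'; rewrite (o _ _ _ _ aa' bb') orth_flip.
Qed.

Lemma corr_biorth H a a' b b' r r' : orth_corr H -> H a a' -> H b b' -> H r r' ->
  biorth a b r -> biorth a' b' r'.
Proof.
move=> [af l ri o] aa' bb' rr' abr c' ac' /[dup] oa' + /[dup] ob' +.
have [c cc'] := ri _ ac'; have [ac _] := af _ _ cc'.
rewrite -(o _ _ _ _ aa' cc') -(o _ _ _ _ bb' cc') -(o _ _ _ _ rr' cc').
exact: abr.
Qed.

Lemma corr_same H a a' b b' : orth_corr H -> H a a' -> H b b' ->
  same a b = same a' b'.
Proof.
have aux K c c' d d' : orth_corr K -> K c c' -> K d d' -> same c d -> same c' d'.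
  move=> oK cc' dd'; have [ac ac'] := corr_antiflag oK cc'.
  have [ad ad'] := corr_antiflag oK dd'.
  move/(biorth_self ad ac)/(corr_biorth oK dd' dd' cc').
  by move/(biorth_self ad' ac').
move=> oH aa' bb'; apply/idP/idP; first exact: aux oH aa' bb'.
exact: aux (orth_corr_sym oH) aa' bb'.
Qed.

Lemma corr_adjacent H a a' b b' : orth_corr H -> H a a' -> H b b' ->
  adjacent a b = adjacent a' b'.
Proof.
have n3 : (3 <= n)%N by apply: leq_trans n4.
have aux K c c' d d' : orth_corr K -> K c c' -> K d d' -> adjacent c d -> adjacent c' d'.
  move=> oK cc' dd'; have [ac ac'] := corr_antiflag oK cc'.
  have [ad ad'] := corr_antiflag oK dd'.
  move/(adjacentP n3 ac ad) => adj; apply/(adjacentP n3 ac' ad') => r' ar' cdr' rc'.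
  have [r rr'] := corr_right oK ar'; have [ar _] := corr_antiflag oK rr'.
  apply: (corr_biorth oK cc' rr' dd'); apply: adj => //.
    exact: (corr_biorth (orth_corr_sym oK) cc' dd' rr').
  by rewrite (corr_same oK rr' cc').
move=> oH aa' bb'; apply/idP/idP; first exact: aux oH aa' bb'.
exact: aux (orth_corr_sym oH) aa' bb'.
Qed.

Definition straight_at H a a' := forall b b', H b b' ->
  (same_point a b -> same_point a' b') /\ (same_form a b -> same_form a' b').

(* Pairwise adjacent antiflags share either the point or the form, so the
   orientation seen on one pair spreads along the adjacency graph. *)
Lemma straight_at_point H a a' b b' : orth_corr H -> H a a' -> H b b' ->
  same_point a b -> ~~ same_form a b -> same_point a' b' -> straight_at H a a'.
Proof.
move=> oH aa' bb' ab1 nab2 ab1' c c' cc'.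
have [[aa ad'] [ab bd']] := (corr_antiflag oH aa', corr_antiflag oH bb').
have [ac cd'] := corr_antiflag oH cc'.
have Sac := corr_same oH aa' cc'; have Sbc := corr_same oH bb' cc'.
have Sab := corr_same oH aa' bb'.
have Aac := corr_adjacent oH aa' cc'; have Abc := corr_adjacent oH bb' cc'.
have ba1 : same_point b a by rewrite same_pointC.
have ba1' : same_point b' a' by rewrite same_pointC.
have nab2' : ~~ same_form a' b' by move: Sab; rewrite /same ab1 ab1' /= => <-.
split=> [ac1|ac2].
  apply/negPn/negP => nac1'.
  have ac2' : same_form a' c'.
    by move: Aac; rewrite /adjacent ac1 (negPf nac1') /= => <-.
  have /esym := Abc; rewrite /adjacent (same_point_trans ba1 ac1) /= => /orP[bc1'|bc2'].
    by rewrite (same_point_trans ab1' bc1') in nac1'.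
  case/negP: nab2'; apply: same_form_trans ac2' _; by rewrite same_formC.
apply/negPn/negP => nac2'.
have ac1' : same_point a' c'.
  by move: Aac; rewrite /adjacent ac2 orbT (negPf nac2') orbF => <-.
have : adjacent b c by rewrite Abc /adjacent (same_point_trans ba1' ac1').
case/orP => [bc1|bc2].
  move: Sac; rewrite /same (same_point_trans ab1 bc1) ac2 (negPf nac2') andbF.
  by [].
by case/negP: nab2; apply: same_form_trans ac2 _; rewrite same_formC.
Qed.

Lemma orth_corr_flip2 H : orth_corr H -> orth_corr (fun a b => H (flip a) (flip b)).
Proof.
by move=> /orth_corr_flip/orth_corr_sym/orth_corr_flip/orth_corr_sym.
Qed.

Lemma straight_at_form H a a' b b' : orth_corr H -> H a a' -> H b b' ->
  same_form a b -> ~~ same_point a b -> same_form a' b' -> straight_at H a a'.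
Proof.
move=> oH aa' bb' ab2 nab1 ab2' c c' cc'.
have [] := @straight_at_point _ (flip a) (flip a') (flip b) (flip b')
  (orth_corr_flip2 oH) _ _ ab2 nab1 ab2' (flip c) (flip c'); rewrite ?flipK //.
Qed.

(** Unless [a] and [b] agree up to scalars, they share exactly one of point and form, and so do
    their images; the pair read backwards then fixes the orientation at [b]. *)
Lemma straight_at_adjacent H a a' b b' : orth_corr H -> H a a' -> H b b' ->
  straight_at H a a' -> adjacent a b -> straight_at H b b'.
Proof.
move=> oH aa' bb' sa adj.
have [[aa ad'] [ab bd']] := (corr_antiflag oH aa', corr_antiflag oH bb').
have [sa1 sa2] := sa _ _ bb'.
have [/andP[ab1 ab2]|] := boolP (same a b).
  have [ab1' ab2'] := (sa1 ab1, sa2 ab2).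
  move=> c c' cc'; have [sc1 sc2] := sa _ _ cc'.
  split=> [bc1|bc2].
    have := sc1 (same_point_trans ab1 bc1); apply: same_point_trans.
    by rewrite same_pointC.
  have := sc2 (same_form_trans ab2 bc2); apply: same_form_trans.
  by rewrite same_formC.
rewrite negb_and => ns; case/orP: adj => [ab1|ab2].
  apply: (straight_at_point oH bb' aa'); rewrite 1?same_pointC ?sa1 //.
  by rewrite same_formC //; move: ns; rewrite ab1.
apply: (straight_at_form oH bb' aa'); rewrite 1?same_formC ?sa2 //.
by rewrite same_pointC //; move: ns; rewrite ab2 orbF.
Qed.

Lemma exists_common_form x y : x != 0 -> y != 0 ->
  exists k, dot k x != 0 /\ dot k y != 0.
Proof.
move=> x0 y0; have [] := @sep1_two _ _ 0 x y; first 1 last.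
- by apply: contra y0 => /submx0null ->.
- by move=> k [_ kx ky]; exists k.
- by apply: contra x0 => /submx0null ->.
Qed.

Lemma straight_everywhere H a a' : orth_corr H -> H a a' -> straight_at H a a' ->
  straight H.
Proof.
move=> oH aa' sa.
have all b b' : H b b' -> straight_at H b b'.
  move=> bb'; have [[aa _] [ab _]] := (corr_antiflag oH aa', corr_antiflag oH bb').
  have [[a0 _] [b0 _]] := (antiflag_neq0 aa, antiflag_neq0 ab).
  (* A form nonzero at both points gives a path of adjacent antiflags from [a] to [b]: change the
     form to [k], then the point, then the form. *)
  have [k [ka kb]] := exists_common_form a0 b0.
  have [c cH] := @corr_left _ oH (a.1, k) ka.
  have [d dH] := @corr_left _ oH (b.1, k) kb.
  have sc : straight_at H (a.1, k) c.
    by apply: (straight_at_adjacent oH aa' cH sa); rewrite /adjacent /same_point submx_refl.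
  have sd : straight_at H (b.1, k) d.
    apply: (straight_at_adjacent oH cH dH sc).
    by rewrite /adjacent /same_form submx_refl orbT.
  by apply: (straight_at_adjacent oH dH bb' sd); rewrite /adjacent /same_point submx_refl.
move=> c c' d d' cc' dd'; have [s1 s2] := all _ _ cc' _ _ dd'.
have Scd := corr_same oH cc' dd'; have Acd := corr_adjacent oH cc' dd'.
(* The converse implications follow from the direct ones because conjunction and disjunction of the
   two relations are preserved. *)
move: Scd Acd s1 s2; rewrite /same /adjacent.
case: (same_point c d) (same_form c d) (same_point c' d') (same_form c' d');
  case; case; case=> //= _ _ s1 s2; try by have := s1 isT.
all: try by have := s2 isT.
Qed.

(** Two antiflags with one point and different forms have adjacent images; whether these share the
    point or the form decides the alternative. *)
Lemma straight_or_flip H : orth_corr H ->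
  straight H \/ straight (fun a b => H a (flip b)).
Proof.
move=> oH.
have [x [f [g [fx gx fg]]]] : exists x f g, [/\ dot f x != 0, dot g x != 0 & ~~ (f <= g)%MS].
  have [x] : exists x : V, x \notin [:: 0].
    have [|x] := @exists_notin F n _ (0 : V); first by rewrite mxrank0; apply: leq_trans n4.
    by move=> x0; exists x; rewrite inE; apply: contra x0 => /eqP ->; rewrite submx_refl.
  rewrite inE => x0; have [h hx] : exists h, dot h x != 0.
    by have [h [hx _]] := exists_common_form x0 x0; exists h.
  have [|y yh] := @exists_notin F n _ h.
    by apply: leq_ltn_trans (rank_leq_row _) _; apply: leq_trans n4.
  have [yx|yx] := eqVneq (dot y x) 0; last by exists x, y, h.
  exists x, (y + h), h; rewrite dotDl yx add0r; split=> //.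
  apply: contra yh => yh; rewrite -[y](addrK h) addmx_sub //.
  by rewrite eqmx_opp submx_refl.
have [a' aa'] := @corr_left _ oH (x, f) fx.
have [b' bb'] := @corr_left _ oH (x, g) gx.
have pt : same_point (x, f) (x, g) by rewrite /same_point submx_refl.
have : adjacent a' b' by rewrite -(corr_adjacent oH aa' bb') /adjacent pt.
case/orP => ab; [left|right].
  exact: straight_everywhere oH aa' (straight_at_point oH aa' bb' pt fg ab).
have oH' := orth_corr_flip oH.
have aa2 : (fun a b => H a (flip b)) (x, f) (flip a') by rewrite flipK.
have bb2 : (fun a b => H a (flip b)) (x, g) (flip b') by rewrite flipK.
exact: straight_everywhere oH' aa2 (straight_at_point oH' aa2 bb2 pt fg ab).
Qed.

End Correspondence.


(** * From straight correspondences to semilinear maps *)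

Section StraightCorrespondence.
Variables (F : fieldType) (n : nat) (n4 : (4 <= n)%N).
Local Notation V := 'rV[F]_n.
Implicit Types (x y z f g h u v : V) (a b c r s : V * V) (H : V * V -> V * V -> Prop).

(** The line of [sigma x] is read off from the image of any antiflag with point [x]; straightness
    makes it independent of the form. *)
Lemma corr_point_map H : orth_corr H -> straight H ->
  exists sigma : V -> V, forall x, x != 0 -> sigma x != 0 /\
    forall a a', H a a' -> (a.1 <= x)%MS = (a'.1 <= sigma x)%MS.
Proof.
move=> oH sH.
suff /functional_choice : forall x, exists u, x != 0 -> u != 0 /\
  forall a a', H a a' -> (a.1 <= x)%MS = (a'.1 <= u)%MS by [].
move=> x; have [x0|x0] := eqVneq x 0; first by exists 0.
have [h [hx _]] := exists_common_form x0 x0.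
have [b' bb'] := @corr_left _ _ _ oH (x, h) hx.
have [_ /antiflag_neq0[b0 _]] := corr_antiflag oH bb'.
exists b'.1 => _; split=> // a a' aa'.
by have [] := sH _ _ _ _ aa' bb'.
Qed.

Lemma straight_flip2 H : straight H -> straight (fun a b => H (flip a) (flip b)).
Proof.
by move=> sH a a' b b' aa' bb'; have [] := sH _ _ _ _ aa' bb'.
Qed.

Lemma corr_form_map H : orth_corr H -> straight H ->
  exists tau : V -> V, forall f, f != 0 -> tau f != 0 /\
    forall a a', H a a' -> (a.2 <= f)%MS = (a'.2 <= tau f)%MS.
Proof.
move=> oH sH.
have [tau tauE] := corr_point_map (orth_corr_flip2 oH) (straight_flip2 sH).
exists tau => f /tauE[t0 tE]; split=> // a a' aa'.
by apply: (tE (flip a) (flip a')); rewrite !flipK.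
Qed.

Lemma corr_semilinear H : orth_corr H -> straight H ->
  exists (phi : {rmorphism F -> F}) (S : 'M[F]_n),
  [/\ bijective phi, S \in unitmx &
      forall a a', H a a' -> exists c d : F, [/\ c != 0, d != 0,
        a'.1 = c *: (map_mx phi a.1 *m S) &
        a'.2 = d *: (map_mx phi a.2 *m (invmx S)^T)]].
Proof.
move=> oH sH; have [sigma sE] := corr_point_map oH sH.
have [tau tE] := corr_form_map oH sH.
(* A nonincident pair is exactly an antiflag, and antiflags correspond in both directions. *)
have incident x f : x != 0 -> f != 0 ->
    (dot f x == 0) = (dot (tau f) (sigma x) == 0).
  move=> x0 f0; have [s0 sx] := sE _ x0; have [t0 tf] := tE _ f0.
  apply/idP/idP; apply: contraLR; [move=> ts|move=> fx].
    have [[y g] yg] := @corr_right _ _ _ oH (sigma x, tau f) ts.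
    have [yg0 _] := corr_antiflag oH yg.
    have := sx _ _ yg; rewrite submx_refl /= => yx.
    have := tf _ _ yg; rewrite submx_refl /= => gf.
    apply: contra yg0 => /eqP fx; rewrite /= (dot_sub yx) //.
    by rewrite dotC (dot_sub gf) // dotC.
  have [a' aa'] := @corr_left _ _ _ oH (x, f) fx.
  have [_ aa] := corr_antiflag oH aa'; have [a10 a20] := antiflag_neq0 aa.
  have := sx _ _ aa'; rewrite submx_refl => /esym ax.
  have := tf _ _ aa'; rewrite submx_refl => /esym af.
  move: aa; rewrite /antiflag; apply: contra => /eqP ts.
  rewrite (dot_sub ax) //.
  by rewrite dotC (dot_sub af) // dotC.
have [||phi [S [bphi Su sS tS]]] := collineation n4 incident.
- by move=> x /sE[].
- move=> u u0; have [h [hu _]] := exists_common_form u0 u0.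
  have [[x f] xf] := @corr_right _ _ _ oH (u, h) hu.
  have [/antiflag_neq0[x0 _] _] := corr_antiflag oH xf.
  by exists x => //; have [_ /(_ _ _ xf)] := sE _ x0; rewrite submx_refl => /esym.
exists phi, S; split=> // a a' aa'.
have [/antiflag_neq0[a1 a2] /antiflag_neq0[a1' a2']] := corr_antiflag oH aa'.
have [c c0 Ec] := sS _ a1; have [d d0 Ed] := tS _ a2.
have [_ /(_ _ _ aa')] := sE _ a1; rewrite submx_refl => /esym/sub_rVP[p Ep].
have [_ /(_ _ _ aa')] := tE _ a2; rewrite submx_refl => /esym/sub_rVP[q Eq].
exists (p * c), (q * d); split; rewrite ?Ep ?Eq ?Ec ?Ed ?scalerA //.
  by rewrite mulf_neq0 //; apply: contraNneq a1' => p0; rewrite Ep p0 scale0r.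
by rewrite mulf_neq0 //; apply: contraNneq a2' => q0; rewrite Eq q0 scale0r.
Qed.

End StraightCorrespondence.

(** * Evaluating the multilinear polynomial *)


Section ProductsOfMatrices.
Variables (F : fieldType) (n : nat).
Implicit Types (A B P Q : 'M[F]_n) (c d : F).

Lemma prod_single k (t : 'I_k) A B :
  \prod_(i < k) (if i == t then B else A) = A ^+ t *m B *m A ^+ (k.-1 - t).
Proof.
rewrite (eq_bigr (fun i : 'I_k => if i == t :> nat then B else A)) //.
rewrite -(big_mkord xpredT (fun i => if i == t :> nat then B else A)).
rewrite (big_cat_nat (leq0n t) (ltnW (ltn_ord t))) /=.
rewrite [X in _ * X]big_ltn //= eqxx.
rewrite !mulmxE -mulrA; congr (_ * (_ * _)).
  rewrite big_nat (eq_bigr (fun=> A)) -?big_nat ?prodr_const_nat ?subn0 //.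
  by move=> i /andP[_ it]; rewrite ltn_eqF.
rewrite big_nat (eq_bigr (fun=> A)) -?big_nat ?prodr_const_nat.
  by congr (_ ^+ _); case: (k) (t) => [[]|] //= *; rewrite subSS.
by move=> i /andP[ti _]; rewrite gtn_eqF.
Qed.

Lemma prod_pair0 k (W : nat -> 'M[F]_n) i :
  (i.+1 < k)%N -> W i *m W i.+1 = 0 -> \prod_(0 <= j < k) W j = 0.
Proof.
move=> ik W0; have ik' := ltnW ik; rewrite (big_cat_nat (leq0n i) (ltnW ik')) /=.
rewrite (big_ltn ik') (big_ltn ik) [X in _ * X]mulrA -!mulmxE W0.
by rewrite mul0mx mulmx0.
Qed.

Lemma prod_triple0 k (W : nat -> 'M[F]_n) i :
  (i.+2 < k)%N -> W i *m W i.+1 *m W i.+2 = 0 -> \prod_(0 <= j < k) W j = 0.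
Proof.
move=> ik W0; have ik' := ltnW ik; have ik2 := ltnW ik'.
rewrite (big_cat_nat (leq0n i) (ltnW ik2)) /=.
rewrite (big_ltn ik2) (big_ltn ik') (big_ltn ik).
rewrite [X in _ * X]mulrA [X in _ * X]mulrA -!mulmxE W0.
by rewrite mul0mx mulmx0.
Qed.

Lemma mul_exp_idem P c m : P *m P = c *: P -> P *m P ^+ m = c ^+ m *: P.
Proof.
move=> PP; elim: m => [|m IH]; first by rewrite !expr0 scale1r mulmxE mulr1.
by rewrite exprSr -mulmxE mulmxA IH -scalemxAl PP scalerA exprSr.
Qed.

Lemma exp_idem_mul P c m : P *m P = c *: P -> P ^+ m *m P = c ^+ m *: P.
Proof. by move=> /mul_exp_idem <-; rewrite !mulmxE -exprSr exprS. Qed.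

(** Since k >= 3, a word with one P, at most one A and otherwise Q contains PQ, QP, PAQ or QAP. *)
Lemma prod_wing0 k a b P Q A : (3 <= k)%N -> (a < k)%N -> (b < k)%N ->
  P *m Q = 0 -> Q *m P = 0 -> P *m A *m Q = 0 -> Q *m A *m P = 0 ->
  \prod_(0 <= i < k) (if i == a then P else if i == b then A else Q) = 0.
Proof.
move=> k3 ak bk PQ QP PAQ QAP;
  pose W i := if i == a then P else if i == b then A else Q;
  change (\prod_(0 <= i < k) W i = 0).
have Wa : W a = P by rewrite /W eqxx.
have Wn i : i != a -> i != b -> W i = Q by rewrite /W => /negPf-> /negPf->.
have Wb i : i != a -> i = b -> W i = A by rewrite /W => /negPf-> ->; rewrite eqxx.
have [a0|a0] := posnP a.
  have [b1|b1] := eqVneq b 1%N.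
    apply: (@prod_triple0 _ _ 0%N); first by lia.
    by rewrite -[X in W X]a0 Wa (Wb 1%N) ?Wn //; lia.
  apply: (@prod_pair0 _ _ 0%N); first by lia.
  by rewrite -[X in W X]a0 Wa Wn //; lia.
have [ba|ba] := eqVneq b a.-1; last first.
  apply: (@prod_pair0 _ _ a.-1); first by lia.
  by rewrite prednK // Wa Wn //; lia.
have [ak1|ak1] := eqVneq a k.-1.
  apply: (@prod_triple0 _ _ a.-2); first by lia.
  have -> : a.-2.+1 = a.-1 by lia.
  by rewrite prednK // Wa (Wb a.-1) ?Wn //; lia.
apply: (@prod_pair0 _ _ a); first by lia.
by rewrite Wa Wn //; lia.
Qed.

(** Framed by P and Q, only the word PAQ...Q survives: in every other one, some P and Q become
    neighbours. *)
Lemma sandwich_prod_wing k a b P Q A c d : (3 <= k)%N -> (a < k)%N -> (b < k)%N ->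
  P *m Q = 0 -> Q *m P = 0 -> P *m P = c *: P -> Q *m Q = d *: Q ->
  P *m (\prod_(0 <= i < k) (if i == a then P else if i == b then A else Q)) *m Q =
  if (a == 0%N) && (b == 1%N) then (c * d ^+ k.-2) *: (P *m A *m Q) else 0.
Proof.
move=> k3 ak bk PQ QP PP QQ.
pose W i := if i == a then P else if i == b then A else Q.
rewrite -[bigop _ _ _]/(\prod_(0 <= i < k) W i).
have Wa : W a = P by rewrite /W eqxx.
have Wn i : i != a -> i != b -> W i = Q by rewrite /W => /negPf-> /negPf->.
have [a0|a0] /= := eqVneq a 0%N.
  have [b1|b1] := eqVneq b 1%N; last first.
    rewrite (@prod_pair0 _ _ 0%N) ?mulmx0 ?mul0mx //; first by lia.
    by rewrite -[X in W X]a0 Wa Wn //; lia.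
  rewrite big_ltn 1?big_ltn //; try lia.
  rewrite -[X in W X]a0 Wa.
  have -> : W 1%N = A by rewrite /W b1 a0.
  have -> : \prod_(2 <= i < k) W i = Q ^+ k.-2.
    rewrite big_nat (eq_bigr (fun=> Q)) -?big_nat ?prodr_const_nat ?subn2 //.
    by move=> i /andP[i2 _]; apply: Wn; lia.
  rewrite -!mulmxE !mulmxA PP -!scalemxAl -mulmxA (exp_idem_mul _ QQ).
  by rewrite -scalemxAr scalerA.
have [b0|b0] := eqVneq b 0%N; last first.
  rewrite big_ltn ?Wn 1?eq_sym //; last by lia.
  by rewrite -mulmxE !mulmxA PQ !mul0mx.
have [ak1|ak1] := eqVneq a k.-1; last first.
  rewrite (@prod_pair0 _ _ a) ?mulmx0 ?mul0mx //; first by lia.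
  by rewrite Wa Wn //; lia.
have {1}-> : k = a.+1 by lia.
by rewrite big_nat_recr //= Wa -mulmxE -!mulmxA PQ !mulmx0.
Qed.

End ProductsOfMatrices.


Section Evaluation.
Variables (F : fieldType) (n k : nat) (k3 : (3 <= k)%N) (alpha : 'S_k -> F).
Hypothesis sum_alpha : \sum_(s : 'S_k) alpha s != 0.
Implicit Types (A B P Q : 'M[F]_n) (c d : F) (s : 'S_k) (j l : 'I_k).

Definition put j B A : 'I_k -> 'M[F]_n := fun i => if i == j then B else A.

Definition wing l j P Q A : 'I_k -> 'M[F]_n :=
  fun i => if i == l then P else if i == j then A else Q.

Definition perp A B := forall j, mleval alpha (put j B A) = 0.

Lemma perm_invE s i j : (s i == j) = (i == s^-1%g j).
Proof. by rewrite -[RHS](inj_eq (@perm_inj _ s)) permKV. Qed.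

Lemma mleval_put j B A : mleval alpha (put j B A) =
  \sum_(s : 'S_k) alpha s *: (A ^+ (s^-1%g j) *m B *m A ^+ (k.-1 - s^-1%g j)).
Proof.
apply: eq_bigr => s _; congr (_ *: _); rewrite -prod_single.
by apply: eq_bigr => i _; rewrite /put perm_invE.
Qed.

Lemma mleval_wing l j P Q A : mleval alpha (wing l j P Q A) =
  \sum_(s : 'S_k) alpha s *: \prod_(0 <= i < k)
    (if i == s^-1%g l :> nat then P else if i == s^-1%g j :> nat then A else Q).
Proof.
apply: eq_bigr => s _; congr (_ *: _); rewrite big_mkord.
by apply: eq_bigr => i _; rewrite /wing !perm_invE.
Qed.

Lemma sum_perm_inv s (V : nmodType) (G : 'I_k -> V) : \sum_j G (s^-1%g j) = \sum_i G i.
Proof.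
by rewrite (reindex_inj (@perm_inj _ s)); apply: eq_bigr => j _; rewrite permK.
Qed.

(** For each permutation, as the slot [j] runs through all indices so does the position of [B];
    hence the coefficient sum factors out. *)
Lemma sum_mleval_put A B : \sum_j mleval alpha (put j B A) =
  (\sum_(s : 'S_k) alpha s) *: \sum_(i < k) A ^+ i *m B *m A ^+ (k.-1 - i).
Proof.
rewrite (eq_bigr _ (fun j _ => mleval_put j B A)) exchange_big scaler_suml.
apply: eq_bigr => s _; rewrite -scaler_sumr; congr (_ *: _).
exact: (sum_perm_inv s (fun i => A ^+ i *m B *m A ^+ (k.-1 - i))).
Qed.

Lemma perp_idem P B c : c != 0 -> P *m P = c *: P ->
  perp P B <-> P *m B = 0 /\ B *m P = 0.
Proof.
move=> c0 PP; split=> [H|[PB BP] j]; last first.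
  rewrite mleval_put big1 // => s _; have := ltn_ord (s^-1%g j).
  case: (nat_of_ord _) => [_|m _]; last first.
    by rewrite exprSr -mulmxE -(mulmxA _ P B) PB mulmx0 mul0mx scaler0.
  rewrite expr0 subn0; case: k k3 => [|[|k']] // _.
  by rewrite exprS mulmxE mul1r -mulmxE mulmxA BP mul0mx scaler0.
have k0 : (0 < k)%N by apply: leq_trans k3.
have ck m : c ^+ m != 0 by rewrite expf_neq0.
(* Between two factors P, all permutations contribute the same nonzero multiple of PBP, so one slot
   suffices. *)
have PBP : P *m B *m P = 0.
  have := H (Ordinal k0) => /(congr1 (fun X => P *m X *m P)).
  rewrite mulmx0 mul0mx mleval_put mulmx_sumr mulmx_suml.
  rewrite (eq_bigr (fun s => alpha s *: (c ^+ k.-1 *: (P *m B *m P)))) => [|s _].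
    rewrite -scaler_suml => /eqP; rewrite !scaler_eq0 (negPf sum_alpha).
    by rewrite (negPf (ck _)) => /eqP.
  rewrite -scalemxAr -scalemxAl; congr (_ *: _).
  rewrite !mulmxA (mul_exp_idem _ PP) -!mulmxA (exp_idem_mul _ PP).
  rewrite -!scalemxAl -!scalemxAr !mulmxA scalerA -exprD subnKC //.
  by rewrite -ltnS prednK // ltn_ord.
(* Multiplied by P on the left, only the last term of this sum survives, the others containing PBP;
   on the right, only the first. *)
have : \sum_(i < k) P ^+ i *m B *m P ^+ (k.-1 - i) = 0.
  apply/eqP; have /eqP := sum_mleval_put P B.
  by rewrite big1 // eq_sym scaler_eq0 (negPf sum_alpha).
have X1 (X : 'M[F]_n) : X *m 1 = X by rewrite mulmxE mulr1.
have E1 (X : 'M[F]_n) : 1 *m X = X by rewrite mulmxE mul1r.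
case: k k3 => // k' k3'; rewrite /= => S0; split.
  move/(congr1 (mulmx P)): S0; rewrite mulmx0 mulmx_sumr big_ord_recr /= big1 => [|i _].
    rewrite subnn expr0 X1 add0r mulmxA (mul_exp_idem _ PP) -scalemxAl.
    by move/eqP; rewrite scaler_eq0 (negPf (ck _)) => /eqP.
  rewrite !mulmxA (mul_exp_idem _ PP) -!scalemxAl.
  have -> : (k' - i = (k' - i).-1.+1)%N by rewrite prednK // subn_gt0.
  by rewrite exprS -mulmxE mulmxA PBP mul0mx scaler0.
move/(congr1 (mulmxr P)): S0; rewrite /= mul0mx mulmx_suml big_ord_recl /= big1 => [|i _].
  rewrite subn0 expr0 addr0 -!mulmxA (exp_idem_mul _ PP) E1 -scalemxAr.
  by move/eqP; rewrite scaler_eq0 (negPf (ck _)) => /eqP.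
rewrite exprSr -mulmxE -!mulmxA (exp_idem_mul _ PP) -!scalemxAr.
by rewrite (mulmxA P) PBP mulmx0 scaler0.
Qed.

Lemma perp_self_neq0 A : perp A A -> A ^+ k = 0.
Proof.
have k0 : (0 < k)%N by apply: leq_trans k3.
move/(_ (Ordinal k0)); rewrite mleval_put (eq_bigr (fun s => alpha s *: A ^+ k)).
  by rewrite -scaler_suml => /eqP; rewrite scaler_eq0 (negPf sum_alpha) => /eqP.
move=> s _; congr (_ *: _); rewrite !mulmxE -exprSr -exprD; congr (_ ^+ _).
have := ltn_ord (s^-1%g (Ordinal k0)); move: (nat_of_ord _) => m; lia.
Qed.

Lemma perp_self_square0 A : A *m A = 0 -> perp A A.
Proof.
move=> AA j; rewrite mleval_put big1 // => s _.
rewrite [X in _ *: X](_ : _ = A *m A *m A ^+ k.-2); first by rewrite AA mul0mx scaler0.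
rewrite !mulmxE -[in RHS]expr2 -exprSr -!exprD; congr (_ ^+ _).
have := ltn_ord (s^-1%g j); move: (nat_of_ord _) => m; lia.
Qed.

Lemma perpZr A B c : perp A B -> perp A (c *: B).
Proof.
move=> AB j; have := AB j; rewrite !mleval_put => E.
have := congr1 (fun X => c *: X) E; rewrite /= scaler0 => cE; rewrite -[RHS]cE.
rewrite scaler_sumr; apply: eq_bigr => s _.
by rewrite -scalemxAr -scalemxAl !scalerA mulrC.
Qed.

(** Left multiplication by [A] commutes with every map sending B to A^i B A^j. The subtracted
    multiple is the form in which the eigenvector argument consumes this stability. *)
Lemma perp_subl A B c : perp A B -> perp A (A *m B - c *: B).
Proof.
move=> AB j; have := AB j; rewrite !mleval_put => E.
have := congr1 (fun X => A *m X - c *: X) E.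
rewrite /= mulmx0 scaler0 subr0 => cE; rewrite -[RHS]cE.
rewrite mulmx_sumr scaler_sumr -sumrB; apply: eq_bigr => s _.
rewrite mulmxBr mulmxBl scalerBr -!scalemxAr -!scalemxAl; congr (_ - _).
  congr (_ *: _); rewrite !mulmxA; congr (_ *m _ *m _).
  by rewrite mulmxE -exprSr exprS.
by rewrite !scalerA mulrC.
Qed.

Lemma perp_subr A B c : perp A B -> perp A (B *m A - c *: B).
Proof.
move=> AB j; have := AB j; rewrite !mleval_put => E.
have := congr1 (fun X => X *m A - c *: X) E.
rewrite /= mul0mx scaler0 subr0 => cE; rewrite -[RHS]cE.
rewrite mulmx_suml scaler_sumr -sumrB; apply: eq_bigr => s _.
rewrite mulmxBr mulmxBl scalerBr -!scalemxAr -!scalemxAl; congr (_ - _).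
  congr (_ *: _); rewrite -!mulmxA; congr (_ *m (_ *m _)).
  by rewrite mulmxE -exprS exprSr.
by rewrite !scalerA mulrC.
Qed.

(** In the sum over all [l] and [j], framed by P and Q, each permutation contributes exactly once,
    when P and A land in the first two positions; so the coefficient sum factors out. *)
Lemma wing_orthogonal P Q A c d : c != 0 -> d != 0 ->
  P *m P = c *: P -> Q *m Q = d *: Q -> P *m Q = 0 -> Q *m P = 0 ->
  (forall l j, mleval alpha (wing l j P Q A) = 0) -> P *m A *m Q = 0.
Proof.
move=> c0 d0 PP QQ PQ QP H.
have : \sum_l \sum_j P *m mleval alpha (wing l j P Q A) *m Q = 0.
  by rewrite big1 // => l _; rewrite big1 // => j _; rewrite H mulmx0 mul0mx.
have k0 : (0 < k)%N by apply: leq_trans k3.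
have k1 : (1 < k)%N by apply: leq_trans k3.
set X := P *m A *m Q; set e := c * d ^+ k.-2.
have e0 : e != 0 by rewrite mulf_neq0 // expf_neq0.
rewrite [LHS](_ : _ = (\sum_(s : 'S_k) alpha s) *: (e *: X)).
  by move/eqP; rewrite !scaler_eq0 (negPf sum_alpha) (negPf e0) => /eqP.
pose G (i i' : 'I_k) := if (i == 0%N :> nat) && (i' == 1%N :> nat) then e *: X else 0.
transitivity (\sum_l \sum_j \sum_(s : 'S_k) alpha s *: G (s^-1%g l) (s^-1%g j)).
  apply: eq_bigr => l _; apply: eq_bigr => j _.
  rewrite mleval_wing mulmx_sumr mulmx_suml; apply: eq_bigr => s _.
  by rewrite -scalemxAr -scalemxAl (@sandwich_prod_wing _ _ _ _ _ _ _ _ c d).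
rewrite (eq_bigr _ (fun l _ => exchange_big _ _ _ _ _ _)) exchange_big scaler_suml.
apply: eq_bigr => s _; rewrite (eq_bigr _ (fun l _ => esym (scaler_sumr _ _ _ _))).
rewrite -scaler_sumr; congr (_ *: _).
rewrite (eq_bigr _ (fun l _ => sum_perm_inv s (G (s^-1%g l)))).
rewrite (sum_perm_inv s (fun i => \sum_i' G i i')).
rewrite (bigD1 (Ordinal k0)) //= [X in _ + X]big1 => [|i i0]; last first.
  rewrite big1 // => i' _; rewrite /G (_ : (i == 0%N :> nat) = false) //.
  by apply/negbTE; apply: contra i0 => /eqP E; apply/eqP/val_inj.
rewrite addr0 (bigD1 (Ordinal k1)) //= [X in _ + X]big1 => [|i i0]; last first.
  rewrite /G /= (_ : (i == 1%N :> nat) = false) //.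
  by apply/negbTE; apply: contra i0 => /eqP E; apply/eqP/val_inj.
by rewrite /G /= addr0.
Qed.

Lemma wingP P Q A c d : c != 0 -> d != 0 ->
  P *m P = c *: P -> Q *m Q = d *: Q -> P *m Q = 0 -> Q *m P = 0 ->
  ((forall l j, mleval alpha (wing l j P Q A) = 0) /\
   (forall l j, mleval alpha (wing l j Q P A) = 0)) <->
  (P *m A *m Q = 0 /\ Q *m A *m P = 0).
Proof.
move=> c0 d0 PP QQ PQ QP; split=> [[PA QA]|[PAQ QAP]]; split.
- exact: (wing_orthogonal c0 d0).
- exact: (wing_orthogonal d0 c0).
- by move=> l j; rewrite mleval_wing big1 // => s _; rewrite prod_wing0 ?scaler0.
- by move=> l j; rewrite mleval_wing big1 // => s _; rewrite prod_wing0 ?scaler0.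
Qed.

End Evaluation.

(** * Rank-one matrices *)


Section CommonEigenvector.
Variables (F : closedFieldType) (n : nat).
Implicit Types (A B : 'M[F]_n) (c : F).

(** By Cayley-Hamilton the product of all A - z over the roots z kills [B]; the last nonzero partial
    product applied to [B] is an eigenvector. *)
Lemma left_eigen A (L : 'M[F]_n -> Prop) B :
  (forall X c, L X -> L (A *m X - c *: X)) -> L B -> B != 0 ->
  exists X c, [/\ L X, X != 0 & A *m X = c *: X].
Proof.
case: n A L B => [|n'] A L B LA LB B0.
  by case/negP: B0; apply/eqP/matrixP => -[].
have [rs charE] := closed_field_poly_normal (char_poly A).
rewrite (monicP (char_poly_monic A)) scale1r in charE.
have: horner_mx A (\prod_(z <- rs) ('X - z%:P)) *m B = 0.
  by rewrite -charE Cayley_Hamilton mul0mx.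
elim: rs B LB B0 {charE} => [|z rs IH] B LB B0.
  by rewrite big_nil rmorph1 mul1mx => B00; rewrite B00 eqxx in B0.
rewrite big_cons mulrC rmorphM rmorphB /= horner_mx_X horner_mx_C -mulmxE -mulmxA.
rewrite mulmxBl mul_scalar_mx => E.
have [E0|E0] := eqVneq (A *m B - z *: B) 0; last by apply: IH E0 E; apply: LA.
by exists B, z; split=> //; apply: subr0_eq.
Qed.

Lemma common_eigenvector A (L : 'M[F]_n -> Prop) B :
  (forall X c, L X -> L (A *m X - c *: X)) ->
  (forall X c, L X -> L (X *m A - c *: X)) -> L B -> B != 0 ->
  exists X c d, [/\ L X, X != 0, A *m X = c *: X & X *m A = d *: X].
Proof.
move=> Ll Lr LB B0; have [X [c [LX X0 XE]]] := left_eigen Ll LB B0.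
(* The same argument for right multiplication runs inside the left eigenspace just found, which
   right multiplication by [A] preserves. *)
have [|||Y [d [[LY YE] Y0 YE']]] :=
    @left_eigen A^T (fun Y => L Y^T /\ A *m Y^T = c *: Y^T) X^T.
- move=> Y d [LY YE].
  have -> : (A^T *m Y - d *: Y)^T = Y^T *m A - d *: Y^T.
    by rewrite linearB linearZ /= trmx_mul trmxK.
  split; first exact: Lr.
  by rewrite mulmxBr -scalemxAr mulmxA YE -scalemxAl scalerBr !scalerA mulrC.
- by rewrite trmxK; split.
- by rewrite trmx_eq0.
exists Y^T, c, d; split=> //; first by rewrite trmx_eq0.
by rewrite -[A]trmxK -trmx_mul YE' linearZ.
Qed.

End CommonEigenvector.

Section RankOne.
Variables (F : fieldType) (n : nat).
Local Notation V := 'rV[F]_n.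
Implicit Types (a b r s : V * V) (A B : 'M[F]_n) (c d : F) (u v : V).

Definition outer a : 'M[F]_n := a.1^T *m a.2.

Lemma outerM a b : outer a *m outer b = dot a.2 b.1 *: (a.1^T *m b.2).
Proof. by rewrite /outer mulmxA -(mulmxA a.1^T) mul_dot mul_mx_scalar -scalemxAl. Qed.

Lemma outer_idem a : outer a *m outer a = dot a.2 a.1 *: outer a.
Proof. exact: outerM. Qed.

Lemma outer_sandwich a b A :
  outer a *m A *m outer b = dot (a.2 *m A) b.1 *: (a.1^T *m b.2).
Proof.
rewrite /outer !mulmxA -(mulmxA _ a.2 A) -(mulmxA _ (a.2 *m A)) mul_dot.
by rewrite mul_mx_scalar -scalemxAl.
Qed.

Lemma outer_eq0 u v : (u^T *m v == 0) = (u == 0) || (v == 0).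
Proof.
apply/idP/idP => [/eqP E|/orP[]/eqP ->]; rewrite ?trmx0 ?mul0mx ?mulmx0 //.
apply/negPn/negP; rewrite negb_or => /andP[/rV0Pn[i ui] /rV0Pn[j vj]].
move/matrixP/(_ i j): E; rewrite !mxE big_ord1 mxE => /eqP.
by rewrite mulf_eq0 (negPf ui) (negPf vj).
Qed.

Lemma scale_outer_eq0 c u v : u != 0 -> v != 0 -> c *: (u^T *m v) = 0 <-> c = 0.
Proof.
move=> u0 v0; split=> [/eqP|->]; last by rewrite scale0r.
by rewrite scaler_eq0 outer_eq0 (negPf u0) (negPf v0) !orbF => /eqP.
Qed.

Lemma rank_outer u v : u != 0 -> v != 0 -> \rank (u^T *m v) = 1%N.
Proof.
move=> u0 v0; apply/eqP; rewrite eqn_leq (leq_trans (mxrankM_maxl _ _)) ?rank_leq_col //.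
by rewrite lt0n mxrank_eq0 outer_eq0 negb_or u0.
Qed.

Lemma orth_outer a b : antiflag a -> antiflag b ->
  orth a b <-> outer a *m outer b = 0 /\ outer b *m outer a = 0.
Proof.
move=> /antiflag_neq0[a1 a2] /antiflag_neq0[b1 b2].
have E u v c : u != 0 -> v != 0 -> c *: (u^T *m v) = 0 <-> c = 0.
  move=> u0 v0; split=> [/eqP|->]; last by rewrite scale0r.
  by rewrite scaler_eq0 outer_eq0 (negPf u0) (negPf v0) !orbF => /eqP.
by rewrite !outerM !E.
Qed.

(** The antiflags orthogonal to [a] involve every nonzero vector killed by [a.2] and every nonzero
    form killing [a.1], so [B] annihilates all of these from its two sides. *)
Lemma proportional_outer a B : antiflag a ->
  (forall b, antiflag b -> orth a b -> outer b *m B = 0 /\ B *m outer b = 0) ->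
  exists c, B = c *: outer a.
Proof.
move=> aa H; have [a1 a2] := antiflag_neq0 aa.
have Br z : dot a.2 z = 0 -> B *m z^T = 0.
  move=> az; have [->|z0] := eqVneq z 0; first by rewrite trmx0 mulmx0.
  have [h ha hz] := sep1 (antiflag_notin aa z0 az).
  have [//|_] := H (z, h) hz; rewrite /outer /= mulmxA => /eqP.
  rewrite -{1}[B *m _]trmxK outer_eq0 trmx_eq0 (negPf (dot_neq0l hz)) orbF.
  by move/eqP.
have Bl h : dot h a.1 = 0 -> h *m B = 0.
  move=> ha; have [->|h0] := eqVneq h 0; first by rewrite mul0mx.
  have [z az zh] : exists2 z, dot z a.2 = 0 & dot z h != 0.
    apply: sep1; apply: (@antiflag_notin _ _ _ a.1) => //; first by rewrite dotC.
    by rewrite dotC.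
  have hz : dot h z != 0 by rewrite dotC.
  have [|] := H (z, h) hz; first by split; rewrite //= dotC.
  rewrite /outer /= -mulmxA => /eqP; rewrite outer_eq0 (negPf (dot_neq0r hz)).
  by move=> /eqP.
set c0 := dot a.2 a.1.
have BE : B = c0^-1 *: (B *m a.1^T *m a.2).
  have BM : B *m (1%:M - c0^-1 *: (a.1^T *m a.2)) = 0.
    set M := _ - _; have aM : a.2 *m M = 0.
      rewrite mulmxBr mulmx1 -scalemxAr mulmxA mul_dot mul_scalar_mx scalerA.
      by rewrite mulVf // scale1r subrr.
    apply/matrixP => i j; transitivity (col j (B *m M) i 0); first by rewrite !mxE.
    rewrite colE -mulmxA -colE -[col j M]trmxK Br ?mxE //.
    by rewrite /dot trmxK colE mulmxA aM mul0mx mxE.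
  apply/eqP; rewrite -subr_eq0; apply/eqP; rewrite -[RHS]BM.
  by rewrite mulmxBr mulmx1 -scalemxAr mulmxA.
have /sub_rVP[c cE] : ((B *m a.1^T)^T <= a.1)%MS.
  apply: dot_sepP => h ah.
  have ha : dot h a.1 = 0 by rewrite dotC /dot ah mxE.
  by rewrite dotC /dot trmxK mulmxA Bl // mul0mx mxE.
exists (c0^-1 * c); rewrite -scalerA; rewrite {1}BE; congr (_ *: _).
by rewrite -[B *m _]trmxK cE linearZ /= -scalemxAl.
Qed.

End RankOne.

(** * Matrices with the same zeros *)


Section ComplementaryIdempotent.
Variables (F : fieldType) (n : nat).
Local Notation V := 'rV[F]_n.
Implicit Types (a b : V * V) (X : 'M[F]_n).

Definition coproj a : 'M[F]_n := 1%:M - (dot a.2 a.1)^-1 *: outer a.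

Lemma coproj_outer a : antiflag a -> coproj a *m outer a = 0.
Proof.
move=> aa; rewrite mulmxBl mul1mx -scalemxAl outer_idem scalerA mulVf //.
by rewrite scale1r subrr.
Qed.

Lemma outer_coproj a : antiflag a -> outer a *m coproj a = 0.
Proof.
move=> aa; rewrite mulmxBr mulmx1 -scalemxAr outer_idem scalerA mulVf //.
by rewrite scale1r subrr.
Qed.

Lemma coproj_idem a : antiflag a -> coproj a *m coproj a = coproj a.
Proof.
by move=> aa; rewrite {2}/coproj mulmxBr mulmx1 -scalemxAr coproj_outer // scaler0 subr0.
Qed.

Lemma rank_coproj a : antiflag a -> \rank (coproj a) = n.-1.
Proof.
move=> aa; have [a1 a2] := antiflag_neq0 aa.
have ro : \rank (outer a) = 1%N by apply: rank_outer.
have := mulmx0_rank_max (coproj_outer aa); rewrite ro.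
have : (\rank (1%:M : 'M[F]_n) <= \rank (coproj a) + \rank (outer a))%N.
  rewrite -[1%:M](subrK ((dot a.2 a.1)^-1 *: outer a)).
  apply: leq_trans (mxrank_add _ _) _; rewrite leq_add2l.
  by rewrite mxrankS // scalemx_sub.
rewrite mxrank1 ro; lia.
Qed.

(** If E is the rank-one idempotent proportional to [outer a], orthogonality to 1 - E means X = EX =
    XE, hence X = EXE. *)
Lemma perp_coproj k (alpha : 'S_k -> F) a X : (3 <= k)%N ->
  \sum_(s : 'S_k) alpha s != 0 -> antiflag a ->
  perp alpha (coproj a) X <-> exists c, X = c *: outer a.
Proof.
move=> k3 sum_alpha aa; have QQ : coproj a *m coproj a = 1 *: coproj a.
  by rewrite scale1r coproj_idem.
rewrite (perp_idem k3 sum_alpha X (oner_neq0 F) QQ); split=> [[QX XQ]|[c ->]].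
  set c := (dot a.2 a.1)^-1.
  have X1 : X = c *: (outer a *m X).
    move/eqP: QX; rewrite mulmxBl mul1mx subr_eq0 -scalemxAl => /eqP.
    exact.
  have X2 : X = c *: (X *m outer a).
    move/eqP: XQ; rewrite mulmxBr mulmx1 subr_eq0 -scalemxAr => /eqP.
    exact.
  exists (c * c * dot (a.2 *m X) a.1).
  by rewrite [LHS]X2 [in LHS]X1 -scalemxAl outer_sandwich !scalerA ?mulrA.
by rewrite -scalemxAr -scalemxAl coproj_outer // outer_coproj // scaler0.
Qed.

End ComplementaryIdempotent.

Section ZeroCorrespondence.
Variables (F : closedFieldType) (n k : nat) (k3 : (3 <= k)%N) (alpha : 'S_k -> F).
Hypothesis sum_alpha : \sum_(s : 'S_k) alpha s != 0.
Local Notation V := 'rV[F]_n.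
Implicit Types (a b r s : V * V) (A B X Y : 'M[F]_n) (G : 'M[F]_n -> 'M[F]_n -> Prop).

(** Satisfied by the graph of [Phi] on [D1], and symmetric, so that every result about images also
    holds for preimages. *)
Record zero_corr G : Prop := ZeroCorr {
  zc_rank1l : forall A, \rank A = 1%N -> exists B, G A B;
  zc_rank1r : forall B, \rank B = 1%N -> exists A, G A B;
  zc_ideml : forall P, P *m P = P -> \rank P = n.-1 -> exists B, G P B;
  zc_idemr : forall P, P *m P = P -> \rank P = n.-1 -> exists A, G A P;
  zc_zeros : forall A B : 'I_k -> 'M[F]_n, (forall i, G (A i) (B i)) ->
    mleval alpha A = 0 <-> mleval alpha B = 0 }.

Lemma zero_corr_sym G : zero_corr G -> zero_corr (fun A B => G B A).
Proof. by case=> l1 r1 li ri z; split=> // A B AB; have [] := z B A AB. Qed.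

Lemma zc_perp G A A' B B' : zero_corr G -> G A A' -> G B B' ->
  perp alpha A B <-> perp alpha A' B'.
Proof.
move=> zG AA' BB'.
have E j : mleval alpha (put j B A) = 0 <-> mleval alpha (put j B' A') = 0.
  by apply: (zc_zeros zG) => i; rewrite /put; case: eqP.
by split=> H j; apply/E.
Qed.

Lemma zc_wing G P P' Q Q' A A' : zero_corr G -> G P P' -> G Q Q' -> G A A' ->
  (forall l j, mleval alpha (wing l j P Q A) = 0) <->
  (forall l j, mleval alpha (wing l j P' Q' A') = 0).
Proof.
move=> zG PP' QQ' AA'.
have E l j : mleval alpha (wing l j P Q A) = 0 <-> mleval alpha (wing l j P' Q' A') = 0.
  by apply: (zc_zeros zG) => i; rewrite /wing; case: eqP => // _; case: eqP.
by split=> H l j; apply/E.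
Qed.

Lemma perp_outer a X : antiflag a ->
  perp alpha (outer a) X <-> outer a *m X = 0 /\ X *m outer a = 0.
Proof. by move=> aa; apply: (perp_idem k3 sum_alpha X aa); apply: outer_idem. Qed.

Lemma outer_neq0 a : antiflag a -> outer a != 0.
Proof. by move=> /antiflag_neq0[a1 a2]; rewrite outer_eq0 negb_or a1. Qed.

Lemma not_perp_outer a : antiflag a -> ~ perp alpha (outer a) (outer a).
Proof.
move=> aa /(perp_outer _ aa)[/eqP]; rewrite outer_idem scaler_eq0.
by rewrite (negPf aa) (negPf (outer_neq0 aa)).
Qed.

(** For a matrix that [A] multiplies by c on the left and by d on the right, the polynomial is a
    scalar depending only on c and d times this matrix. A common eigenmatrix Y shows that scalar to
    be 0, and a column of Y times a row of Y obeys the same relations. *)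
Lemma perp_rank1 A X : perp alpha A X -> X != 0 ->
  exists r, [/\ r.1 != 0, r.2 != 0 & perp alpha A (outer r)].
Proof.
move=> AX X0; have [Y [c [d [AY Y0 Yc Yd]]]] :=
  common_eigenvector (fun X c => @perp_subl _ _ _ alpha A X c)
                     (fun X c => @perp_subr _ _ _ alpha A X c) AX X0.
have [i [j Yij]] : exists i j, Y i j != 0.
  apply: NNPP => no; case/negP: Y0; apply/eqP/matrixP => i j; rewrite mxE.
  by apply/eqP/negPn/negP => Yij; apply: no; exists i, j.
have expl m (Z : 'M[F]_n) : A *m Z = c *: Z -> A ^+ m *m Z = c ^+ m *: Z.
  move=> AZ; elim: m => [|m IH]; first by rewrite expr0 scale1r mulmxE mul1r.
  by rewrite exprSr -mulmxE -mulmxA AZ -scalemxAr IH scalerA exprS.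
have expr m (Z : 'M[F]_n) : Z *m A = d *: Z -> Z *m A ^+ m = d ^+ m *: Z.
  move=> AZ; elim: m => [|m IH]; first by rewrite expr0 scale1r mulmxE mulr1.
  by rewrite exprS -mulmxE mulmxA AZ -scalemxAl IH scalerA exprS.
have val (Z : 'M[F]_n) l : A *m Z = c *: Z -> Z *m A = d *: Z ->
    mleval alpha (put l Z A) =
    (\sum_(s : 'S_k) alpha s * (c ^+ (s^-1%g l) * d ^+ (k.-1 - s^-1%g l))) *: Z.
  move=> Zc Zd; rewrite mleval_put scaler_suml; apply: eq_bigr => s _.
  by rewrite expl // -scalemxAl expr // !scalerA mulrA.
exists ((col j Y)^T, row i Y); split.
- apply/rV0Pn; exists i; by rewrite !mxE.
- apply/rV0Pn; exists j; by rewrite !mxE.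
move=> l; rewrite val /outer /= ?trmxK.
- have /eqP := AY l; rewrite val // scaler_eq0 (negPf Y0) orbF => /eqP ->.
  by rewrite scale0r.
- by rewrite colE !mulmxA Yc -!scalemxAl.
- by rewrite rowE -!mulmxA Yd -!scalemxAr.
Qed.

Lemma zc_antiflag G a B : zero_corr G -> antiflag a -> G (outer a) B ->
  exists2 b, antiflag b & B = outer b.
Proof.
move=> zG aa aB.
have [Q' QQ'] := zc_ideml zG (coproj_idem aa) (rank_coproj aa).
have QB : perp alpha Q' B.
  rewrite -(zc_perp zG QQ' aB); apply/(perp_coproj _ k3 sum_alpha aa).
  by exists 1; rewrite scale1r.
have B0 : B != 0.
  apply/eqP => B0; apply: (not_perp_outer aa); rewrite (zc_perp zG aB aB) B0.
  by apply: perp_self_square0; rewrite // mulmx0.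
have [r [r1 r2 Qr]] := perp_rank1 QB B0.
have [A Ar] : exists A, G A (outer r) := zc_rank1r zG (rank_outer r1 r2).
move: Qr; rewrite -(zc_perp zG QQ' Ar) => /(perp_coproj _ k3 sum_alpha aa)[c AE].
(* If [A] were 0, everything would be orthogonal to it, including a preimage of an antiflag with the
   point of [r], which is not orthogonal to [outer r]. *)
have c0 : c != 0.
  have [h [hr _]] := exists_common_form r1 r1.
  have as_ : antiflag (r.1, h) by [].
  have [S SE] : exists S, G S (outer (r.1, h)).
    exact: zc_rank1r zG _ (rank_outer r1 (dot_neq0l hr)).
  apply/eqP => c0; have : perp alpha S A.
    rewrite AE c0 scale0r => j; rewrite mleval_put big1 // => s _.
    by rewrite mulmx0 mul0mx scaler0.
  rewrite (zc_perp zG SE Ar) => /(perp_outer (outer r) as_)[+ _].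
  rewrite outerM => /eqP; rewrite scaler_eq0 outer_eq0.
  by rewrite (negPf r1) (negPf r2) !orbF /= (negPf hr).
(* Otherwise [outer r] squares to 0 and is orthogonal to itself, so a nonzero multiple of [outer a]
   would be nilpotent. *)
have ar : antiflag r.
  apply/negP => /eqP rr; apply: (not_perp_outer aa).
  have : perp alpha (outer r) (outer r).
    by apply: perp_self_square0; rewrite // outer_idem rr scale0r.
  rewrite -(zc_perp zG Ar Ar) AE.
  move=> /(perp_self_neq0 k3 sum_alpha) E.
  exfalso; move: E; rewrite -[k]prednK ?(leq_trans _ k3) //.
  have cc : (c *: outer a) *m (c *: outer a) = (c * dot a.2 a.1) *: (c *: outer a).
    by rewrite -scalemxAl -scalemxAr outer_idem !scalerA; congr (_ *: _); ring.
  rewrite exprS -mulmxE (mul_exp_idem _ cc) => /eqP.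
  by rewrite !scaler_eq0 expf_eq0 mulf_eq0 (negPf c0) (negPf aa) (negPf (outer_neq0 aa)) andbF.
(* An antiflag orthogonal to [r] has a preimage orthogonal to [A], hence to its multiple [outer a];
   so it is itself orthogonal to [B]. *)
have [c' BE] : exists c', B = c' *: outer r.
  apply: proportional_outer => // s as_ rs.
  have [s1 s2] := antiflag_neq0 as_.
  have [S SE] : exists S, G S (outer s) := zc_rank1r zG (rank_outer s1 s2).
  apply/(perp_outer B as_); rewrite -(zc_perp zG SE aB).
  rewrite -[outer a](scalerK c0) -AE; apply: perpZr.
  rewrite (zc_perp zG SE Ar); apply/(perp_outer _ as_).
  by apply/orth_outer => //; apply/orthC.
exists (r.1, c' *: r.2).
  rewrite /antiflag /= dotZl mulf_neq0 //.
  by apply: contraNneq B0 => c0'; rewrite BE c0' scale0r.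
by rewrite BE /outer /= scalemxAr.
Qed.

Definition antiflag_corr G a b := [/\ antiflag a, antiflag b & G (outer a) (outer b)].

Lemma zc_orth_corr G : zero_corr G -> orth_corr (antiflag_corr G).
Proof.
move=> zG; split.
- by move=> a a' [].
- move=> a aa; have [a1 a2] := antiflag_neq0 aa.
  have [B aB] := zc_rank1l zG (rank_outer a1 a2).
  have [b ab BE] := zc_antiflag zG aa aB.
  by exists b; split; rewrite -?BE.
- move=> a' aa; have [a1 a2] := antiflag_neq0 aa.
  have [B aB] := zc_rank1r zG (rank_outer a1 a2).
  have [b ab BE] := zc_antiflag (zero_corr_sym zG) aa aB.
  by exists b; split; rewrite -?BE.
move=> a a' b b' [aa aa' Ga] [ab ab' Gb].
rewrite !orth_outer // -!perp_outer //.
exact: (zc_perp zG Ga Gb).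
Qed.

Lemma zc_offdiagonal G a a' b b' A A' : zero_corr G ->
  antiflag_corr G a a' -> antiflag_corr G b b' -> G A A' -> orth a b ->
  (dot (a.2 *m A) b.1 = 0 /\ dot (b.2 *m A) a.1 = 0) <->
  (dot (a'.2 *m A') b'.1 = 0 /\ dot (b'.2 *m A') a'.1 = 0).
Proof.
move=> zG Ga Gb AA' oab.
have E c d B : antiflag c -> antiflag d -> orth c d ->
    (dot (c.2 *m B) d.1 = 0 /\ dot (d.2 *m B) c.1 = 0) <->
    ((forall l j, mleval alpha (wing l j (outer c) (outer d) B) = 0) /\
     (forall l j, mleval alpha (wing l j (outer d) (outer c) B) = 0)).
  move=> ac ad /[dup] ocd /(orth_outer ac ad)[cd dc].
  rewrite (wingP k3 sum_alpha B ac ad (outer_idem c) (outer_idem d) cd dc).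
  rewrite !outer_sandwich.
  have [[c1 c2] [d1 d2]] := (antiflag_neq0 ac, antiflag_neq0 ad).
  by rewrite !scale_outer_eq0.
have oab' : orth a' b' by apply/(corr_orth (zc_orth_corr zG) Ga Gb).
case: Ga Gb => aa aa' Ga [ab ab' Gb].
rewrite (E a b) // (E a' b') //.
by rewrite (zc_wing zG Ga Gb AA') (zc_wing zG Gb Ga AA').
Qed.

End ZeroCorrespondence.

(** * Conclusion *)


Lemma dot_map (F : fieldType) n (phi : {rmorphism F -> F}) (f x : 'rV[F]_n) :
  dot (map_mx phi f) (map_mx phi x) = phi (dot f x).
Proof. by rewrite /dot map_trmx -map_mxM mxE. Qed.

Definition offdiagonal (F : fieldType) n (A : 'M[F]_n) (a b : 'rV[F]_n * 'rV[F]_n) :=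
  dot (a.2 *m A) b.1 = 0 /\ dot (b.2 *m A) a.1 = 0.

(** Moving [S] from the vectors and forms onto [B] makes its conjugate comparable with the image of
    [A] under [phi]; as [phi] is onto, all vectors and forms are reached. *)
Lemma semilinear_conjugate (F : closedFieldType) n (phi : {rmorphism F -> F})
    (S A B : 'M[F]_n)
    (img := fun a : 'rV[F]_n * 'rV[F]_n =>
       (map_mx phi a.1 *m S, map_mx phi a.2 *m (invmx S)^T)) :
  (4 <= n)%N -> bijective phi -> S \in unitmx ->
  (forall a b, antiflag a -> antiflag b -> orth a b ->
     offdiagonal A a b <-> offdiagonal B (img a) (img b)) ->
  exists c d, c != 0 /\ B = c *: (S^T *m map_mx phi A *m invmx S^T) + d%:M.
Proof.
move=> n4 [psi phiK psiK] Su H; have Stu : S^T \in unitmx by rewrite unitmx_tr.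
have psiE (x : 'rV_n) : exists y, x = map_mx phi y.
  by exists (map_mx psi x); apply/rowP => i; rewrite !mxE psiK.
have [||c [d [c0 E]]] :=
    @local_orthogonal F n (map_mx phi A) ((invmx S)^T *m B *m S^T) => //.
  move=> x' f' y' g'.
  have [[x ->] [f ->]] := (psiE x', psiE f').
  have [[y ->] [g ->]] := (psiE y', psiE g').
  rewrite -!map_mxM !dot_map !fmorph_eq0 => fx gy.
  move=> /eqP; rewrite fmorph_eq0 => /eqP fy /eqP; rewrite fmorph_eq0 => /eqP gx.
  have P (e : F) : phi e = 0 <-> e = 0.
    by split=> [/eqP|->]; [rewrite fmorph_eq0 => /eqP | rewrite rmorph0].
  rewrite !P !mulmxA (dotM _ S^T) (dotM _ S^T (map_mx phi x)) trmxK.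
  exact: (H (x, f) (y, g) fx gy (conj fy gx)).
exists c, d; split=> //.
have -> : B = S^T *m ((invmx S)^T *m B *m S^T) *m invmx S^T.
  by rewrite trmx_inv -!mulmxA mulmxV // mulmx1 mulKVmx.
rewrite E mulmxDr mulmxDl -scalemxAr -scalemxAl; congr (_ + _).
by rewrite mul_mx_scalar -scalemxAl mulmxV // scalemx1.
Qed.

Lemma offdiagonal_scale (F : fieldType) n (A : 'M[F]_n) a b
    (p q p' q' : F) (x f y g : 'rV[F]_n) :
  p != 0 -> q != 0 -> p' != 0 -> q' != 0 ->
  a = (p *: x, q *: f) -> b = (p' *: y, q' *: g) ->
  offdiagonal A a b <-> offdiagonal A (x, f) (y, g).
Proof.
move=> p0 q0 p'0 q'0 -> ->; rewrite /offdiagonal /= -!scalemxAl !dotZl !dotZr.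
have E (e c c' : F) : c != 0 -> c' != 0 -> c * (c' * e) = 0 <-> e = 0.
  move=> c0 c'0; split=> [/eqP|->]; last by rewrite !mulr0.
  by rewrite !mulf_eq0 (negPf c0) (negPf c'0) => /eqP.
by rewrite !E.
Qed.

Lemma straight_conjugate (F : closedFieldType) n (K : _ -> _ -> Prop) :
  (4 <= n)%N -> @orth_corr F n K -> straight K ->
  exists (phi : {rmorphism F -> F}) (S : 'M[F]_n), [/\ bijective phi, S \in unitmx &
    forall A B : 'M[F]_n,
      (forall a a' b b', K a a' -> K b b' -> orth a b ->
         offdiagonal A a b <-> offdiagonal B a' b') ->
      exists c d, c != 0 /\ B = c *: (S^T *m map_mx phi A *m invmx S^T) + d%:M].
Proof.
move=> n4 oK sK; have [phi [S [bphi Su KS]]] := corr_semilinear n4 oK sK.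
exists phi, S; split=> // A B H; apply: semilinear_conjugate => // a b aa ab oab.
have [a' Ka] := corr_left oK aa; have [b' Kb] := corr_left oK ab.
rewrite (H _ _ _ _ Ka Kb oab).
have [p [q [p0 q0 a1 a2]]] := KS _ _ Ka; have [p' [q' [p'0 q'0 b1 b2]]] := KS _ _ Kb.
apply: offdiagonal_scale p0 q0 p'0 q'0 _ _; first by rewrite -a1 -a2; case: (a').
by rewrite -b1 -b2; case: (b').
Qed.

(** Transposition exchanges vectors and forms, which reduces a flipped correspondence to a straight
    one. *)
Lemma offdiagonal_tr (F : fieldType) n (A : 'M[F]_n) a b :
  offdiagonal A^T a b <-> offdiagonal A (flip a) (flip b).
Proof.
rewrite /offdiagonal /= !(dotM _ A) !(dotC (_ *m A^T)); tauto.
Qed.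

Theorem corollary2p3 (F : closedFieldType) (charF : 2%N \notin [pchar F])
  (n k : nat) (n_ge4 : (4 <= n)%N) (k_ge3 : (3 <= k)%N)
  (alpha : 'S_k -> F) (sum_alpha : \sum_(s : 'S_k) alpha s != 0)
  (D1 D2 : 'M[F]_n -> Prop)
  (D1_rank1 : contains_rank1 D1)
  (D1_idem : contains_corank1_idempotents D1)
  (D2_rank1 : contains_rank1 D2)
  (D2_idem : contains_corank1_idempotents D2)
  (Phi : 'M[F]_n -> 'M[F]_n)
  (Phi_surj : surjection_between D1 D2 Phi)
  (Phi_zeros : strongly_preserves_zeros alpha D1 Phi) :
  exists (phi : {rmorphism F -> F}) (gamma mu : 'M[F]_n -> F) (T : 'M[F]_n),
    [/\ bijective phi,
        forall A, D1 A -> A != 0 -> gamma A != 0,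
        T \in unitmx &
        (forall A, D1 A ->
           Phi A = gamma A *: (T *m map_mx phi A *m invmx T) + (mu A)%:M) \/
        (forall A, D1 A ->
           Phi A = gamma A *: (T *m (map_mx phi A)^T *m invmx T) + (mu A)%:M)].
Proof.
have [_ Phi_onto] := Phi_surj.
pose G A B := D1 A /\ Phi A = B.
have zG : zero_corr alpha G.
  split.
  - by move=> A /D1_rank1 DA; exists (Phi A).
  - by move=> B /D2_rank1/Phi_onto[A DA AB]; exists A.
  - by move=> P PP /(D1_idem P PP) DP; exists (Phi P).
  - by move=> P PP /(D2_idem P PP)/Phi_onto[A DA AP]; exists A.
  - move=> A B AB; have [DA AE] : (forall i, D1 (A i)) /\ forall i, Phi (A i) = B i.
      by split=> i; case: (AB i).
    rewrite (Phi_zeros A DA) /mleval.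
    under eq_bigr => s _ do under eq_bigr => i _ do rewrite AE.
    by [].
have oH := zc_orth_corr k_ge3 sum_alpha zG.
have GA A : D1 A -> G A (Phi A) by [].
have choose (Psi : 'M[F]_n -> 'M[F]_n) :
    (forall A, D1 A -> exists c d, c != 0 /\ Phi A = c *: Psi A + d%:M) ->
    exists gamma mu : 'M[F]_n -> F, (forall A, D1 A -> A != 0 -> gamma A != 0) /\
      forall A, D1 A -> Phi A = gamma A *: Psi A + (mu A)%:M.
  move=> H; have /functional_choice[g gE] : forall A, exists cd : F * F,
      D1 A -> cd.1 != 0 /\ Phi A = cd.1 *: Psi A + cd.2%:M.
    move=> A; case: (classic (D1 A)) => [/H[c [d cd]]|nD]; first by exists (c, d).
    (* Outside [D1] the scalars are arbitrary. *)
    by exists (0, 0).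
  exists (fun A => (g A).1), (fun A => (g A).2).
  by split=> A DA; have [] := gE A DA.
have [sH|sH] := straight_or_flip n_ge4 oH.
  have [phi [S [bphi Su conj]]] := straight_conjugate n_ge4 oH sH.
  have [|gamma [mu [g0 PE]]] := choose (fun A => S^T *m map_mx phi A *m invmx S^T).
    move=> A DA; apply: conj => a a' b b' Ha Hb.
    exact: (zc_offdiagonal k_ge3 sum_alpha zG Ha Hb (GA A DA)).
  by exists phi, gamma, mu, S^T; split=> //; [rewrite unitmx_tr | left].
have [phi [S [bphi Su conj]]] := straight_conjugate n_ge4 (orth_corr_flip oH) sH.
have [|gamma [mu [g0 PE]]] :=
    choose (fun A => invmx S *m (map_mx phi A)^T *m invmx (invmx S)).
  (* The straight result describes the transpose of [Phi A]; transposing back turns conjugation by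
     [S^T] into conjugation by [invmx S]. *)
  move=> A DA; have [|c [d [c0 E]]] := conj A (Phi A)^T.
    move=> a a' b b' Ha Hb oab; rewrite offdiagonal_tr.
    exact: (zc_offdiagonal k_ge3 sum_alpha zG Ha Hb (GA A DA)).
  exists c, d; split=> //; rewrite -[Phi A]trmxK E linearD linearZ /= tr_scalar_mx.
  by rewrite !trmx_mul trmxK -trmx_inv trmxK invmxK mulmxA.
by exists phi, gamma, mu, (invmx S); split=> //; [rewrite unitmx_inv | right].
Qed.
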